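(* Let $K$ be a simplicial complex. If $K$ contains $P^2_6$ (the $6$-vertex triangulation of $\mathbb RP^2$) as a full subcomplex, then there is a non-trivial $Sq^1$ in $H^*(\mathcal Z_K)$, i.e. $Sq^1\colon H^*(\mathcal Z_K)\to H^{*+1}(\mathcal Z_K)$ is non-zero.
   Context: $H^*(-)$ denotes cohomology with $\mathbb F_2$ coefficients and $Sq^1$ is the first mod 2 Steenrod square. $P^2_6$ is the triangulation of $\mathbb RP^2$ on vertices $1,\dots,6$ with the ten facets $\{1,2,3\},\{1,2,6\},\{1,3,5\},\{1,4,5\},\{1,4,6\},\{2,3,4\},\{2,4,5\},\{2,5,6\},\{3,4,6\},\{3,5,6\}$. Containing $P_6^2$ as a full subcomplex means that for some subset $J$ of the vertices, the full subcomplex $K_J$ is isomorphic to $P^2_6$. For a simplicial complex $K$ with vertex set $[m]=\{1,\dots,m\}$, the moment-angle complex is $\mathcal Z_K=(D^2,S^1)^K=\bigcup_{\sigma\in K}\prod_{i=1}^mY_i^\sigma\subseteq(D^2)^m$ with $Y_i^\sigma=D^2$ if $i\in\sigma$ and $Y_i^\sigma=S^1$ if $i\notin\sigma$. *)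

(* Defs.v *)
From HB Require Import structures.
From mathcomp Require Import all_boot all_order all_algebra ring_quotient.
From mathcomp Require Import zify ring.
From mathcomp Require Import all_classical reals topology normedtype.
Import Order.TTheory GRing.Theory Num.Theory numFieldNormedType.Exports.

Set Implicit Arguments.
Unset Strict Implicit.
Unset Printing Implicit Defensive.

Local Open Scope classical_set_scope.
Local Open Scope quotient_scope.
Local Open Scope ring_scope.

Lemma ptws_continuous (I : Type) (T U : topologicalType)
    (g : T -> {ptws I -> U}) :
  (forall i, continuous (fun t => g t i)) -> continuous g.
Proof.
move=> gc t; apply/cvg_sup => i; move: t.
apply/(@continuousP _ (initial_topology (fun f : I -> U => f i))).
by move=> A [B oB <-]; have /continuousP := gc i; apply.
Qed.

Section SingularSimplices.
Context (R : realType).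

Definition std_simplex_set (n : nat) : set {ptws 'I_n.+1 -> R} :=
  [set t | (forall i, 0 <= t i) /\ \sum_(i < n.+1) t i = 1].
Arguments std_simplex_set : clear implicits.

Definition std_simplex (n : nat) : topologicalType :=
  set_type (std_simplex_set n).

(* The affine map of standard simplices that sends the vertex i to f i. *)
Definition vertex_push p q (f : 'I_p.+1 -> 'I_q.+1)
    (t : {ptws 'I_p.+1 -> R}) : {ptws 'I_q.+1 -> R} :=
  fun j => \sum_(i < p.+1 | f i == j) t i.

Lemma vertex_push_simplex p q (f : 'I_p.+1 -> 'I_q.+1) (t : std_simplex p) :
  vertex_push f (\val t) \in std_simplex_set q.
Proof.
case: t => t /= /set_mem [t0 t1]; apply/mem_set; split=> [j|].
  exact: sumr_ge0.
by rewrite -t1 /vertex_push (partition_big f xpredT) //=.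
Qed.

Definition simplex_map_fun p q (f : 'I_p.+1 -> 'I_q.+1) (t : std_simplex p) :
  std_simplex q :=
  exist (fun u => u \in std_simplex_set q) _ (vertex_push_simplex f t).

Lemma vertex_push_continuous p q (f : 'I_p.+1 -> 'I_q.+1) :
  continuous (vertex_push f).
Proof.
apply: ptws_continuous => j; apply: continuous_big => [|i _].
  exact: add_continuous.
exact: (@proj_continuous _ (fun=> R : topologicalType)).
Qed.

Lemma simplex_map_continuous p q (f : 'I_p.+1 -> 'I_q.+1) :
  continuous (simplex_map_fun f).
Proof.
apply: continuous_comp_initial => t. rewrite /=.
apply: (@continuous_comp _ _ _ set_val (vertex_push f)).
  exact: initial_continuous.
exact: vertex_push_continuous.
Qed.

HB.instance Definition _ p q (f : 'I_p.+1 -> 'I_q.+1) :=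
  @isContinuous.Build _ _ (simplex_map_fun f) (@simplex_map_continuous p q f).

Definition simplex_map p q (f : 'I_p.+1 -> 'I_q.+1) :
  continuousType (std_simplex p) (std_simplex q) := simplex_map_fun f.

Definition singular_simplex (X : topologicalType) (n : nat) :=
  continuousType (std_simplex n) X.

Definition simplex_pull (X : topologicalType) p q (f : 'I_p.+1 -> 'I_q.+1)
    (s : singular_simplex X q) : singular_simplex X p :=
  s \o simplex_map f.

Lemma simplex_pull_comp (X : topologicalType) p q r (f : 'I_p.+1 -> 'I_q.+1)
    (g : 'I_q.+1 -> 'I_r.+1) (s : singular_simplex X r) :
  simplex_pull f (simplex_pull g s) = simplex_pull (g \o f) s.
Proof.
apply/continuousEP => t /=; congr (s _); apply/val_inj/funext => j /=.
rewrite /vertex_push (partition_big f (fun i => g i == j)) //=.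
apply: eq_bigr => i /eqP gi; apply: eq_bigl => k.
by case: (f k =P i) => [->|]; rewrite ?gi ?eqxx ?andbF.
Qed.

Definition cochain (A : nzRingType) (X : topologicalType) (n : nat) :=
  singular_simplex X n -> A.

HB.instance Definition _ A X n := GRing.Zmodule.on (cochain A X n).

End SingularSimplices.

Lemma bump_bump (i j k : nat) : (j < i)%N ->
  bump i (bump j k) = bump j (bump i.-1 k).
Proof.
rewrite /bump; case: (leqP j k) => h1; case: (leqP i.-1 k) => h2 h;
  rewrite ?add1n ?add0n; case: leqP => h3; case: leqP => h4;
  rewrite ?add1n ?add0n //; exfalso; lia.
Qed.

Section SingularCohomology.
Context (R : realType) (A : nzRingType) (X : topologicalType).
Local Notation cochain := (cochain R A X).

Definition coboundary n (x : cochain n) : cochain n.+1 :=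
  fun s => \sum_(i < n.+2) (-1) ^+ i * x (simplex_pull (lift i) s).

Lemma coboundary_is_zmod_morphism n : zmod_morphism (@coboundary n).
Proof.
move=> x y; apply/funext => s.
rewrite /coboundary /= /GRing.add /GRing.opp /= -sumrB.
by apply: eq_bigr => i _; rewrite -mulrBr.
Qed.

HB.instance Definition _ n :=
  GRing.isZmodMorphism.Build _ _ (@coboundary n)
    (@coboundary_is_zmod_morphism n).

Lemma lift_lift n (i : 'I_n.+3) (j : 'I_n.+2) : (j < i)%N ->
  lift i \o lift j =1
  lift (widen_ord (leqnSn n.+2) j) \o lift (inord i.-1 : 'I_n.+2).
Proof.
move=> ltji k; apply: val_inj => /=.
have i1 : (inord i.-1 : 'I_n.+2) = i.-1 :> nat.
  by rewrite inordK //; case: i ltji => [[|i]].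
by rewrite i1; exact: bump_bump.
Qed.

Lemma coboundaryK n (x : cochain n) : coboundary (coboundary x) = 0.
Proof.
apply/funext => s; rewrite /coboundary /=.
under eq_bigr do rewrite mulr_sumr.
rewrite pair_big /= (bigID (fun p : 'I_n.+3 * 'I_n.+2 => (p.2 < p.1)%N)) /=.
pose h (p : 'I_n.+3 * 'I_n.+2) : 'I_n.+3 * 'I_n.+2 :=
  (widen_ord (leqnSn n.+2) p.2, inord p.1.-1).
pose g (p : 'I_n.+3 * 'I_n.+2) : 'I_n.+3 * 'I_n.+2 :=
  (lift ord0 p.2, inord p.1).
have lt1 (p : 'I_n.+3 * 'I_n.+2) : (p.2 < p.1)%N ->
    (inord p.1.-1 : 'I_n.+2) = p.1.-1 :> nat.
  by move=> lt; rewrite inordK //; have := ltn_ord p.1; lia.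
rewrite [X in _ + X](reindex_onto h g) /=; last first.
  move=> [i j] /=; rewrite -leqNgt => leij.
  have ltin : (i < n.+2)%N by have := ltn_ord j; lia.
  congr (_, _); apply: val_inj => /=; first by rewrite inordK.
  by rewrite inordK /bump /= add0n.
rewrite [X in _ + X](_ : _ = - \sum_(p : 'I_n.+3 * 'I_n.+2 | (p.2 < p.1)%N)
    (-1) ^+ p.1 * ((-1) ^+ p.2 *
      x (simplex_pull (lift p.2) (simplex_pull (lift p.1) s)))).
  by rewrite subrr.
rewrite -sumrN; apply: eq_big => [[i j]|[i j]] /=.
  have [ltji|leij] := ltnP j i.
    rewrite (lt1 (i, j) ltji) /= -leqNgt; apply/andP; split; first by lia.
    apply/eqP; congr (_, _); apply: val_inj => /=.
      by rewrite (lt1 (i, j) ltji) /bump /=; lia.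
    by rewrite inordK.
  apply/negbTE/negP => /andP[+ /eqP [e1]].
  have : (i.-1 < n.+2)%N by have := ltn_ord j; lia.
  move=> i1; rewrite inordK //.
  move: e1; rewrite /lift /= => /(congr1 val); rewrite /= /bump inordK //=.
  lia.
move=> /andP[nlt /eqP [e1 _]].
have ltji : (j < i)%N.
  move: e1 => /(congr1 val); rewrite /= /bump /= => e1.
  by move: nlt; lia.
rewrite (lt1 (i, j) ltji) /=.
rewrite !mulrA -!exprD !simplex_pull_comp (funext (lift_lift ltji)).
rewrite -mulNr; congr (_ * _).
have -> : (i + j)%N = (j + i.-1).+1 by lia.
by rewrite exprS mulN1r opprK.
Qed.

End SingularCohomology.

Section Cohomology.
Context (R : realType) (A : nzRingType) (X : topologicalType).

Definition is_coboundary n : cochain R A X n -> Prop :=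
  match n with
  | 0 => fun x => x = 0
  | m.+1 => fun x => exists y : cochain R A X m, x = coboundary y
  end.

Definition cocycle_pred n : {pred cochain R A X n} :=
  [pred x | coboundary x == 0].

Lemma cocycle_zmod_closed n : zmod_closed (@cocycle_pred n).
Proof.
split=> [|x y]; first by rewrite inE raddf0.
move=> /eqP x0 /eqP y0; rewrite inE raddfB; apply/eqP.
by rewrite /= in x0 y0 *; rewrite x0 y0 subr0.
Qed.

HB.instance Definition _ n :=
  GRing.isZmodClosed.Build _ (@cocycle_pred n) (@cocycle_zmod_closed n).
Record cocycles n := Cocycle {
  cocycle_val :> cochain R A X n;
  cocycleP : cocycle_val \in @cocycle_pred n }.

HB.instance Definition _ n := [isSub for @cocycle_val n].
HB.instance Definition _ n := [Choice of cocycles n by <:].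
HB.instance Definition _ n :=
  [SubChoice_isSubZmodule of cocycles n by <:].

Definition coboundaries n : {pred cocycles n} :=
  [pred x : cocycles n | `[< is_coboundary (cocycle_val x) >]].

Lemma coboundaries_zmod_closed n : zmod_closed (@coboundaries n).
Proof.
split=> [|x y].
  by apply/asboolP; case: n => [//|n] /=; exists 0; rewrite raddf0.
move=> /asboolP xb /asboolP yb; apply/asboolP.
case: n x y xb yb => [|n] x y /=; first by move=> x0 y0; rewrite x0 y0 subrr.
by move=> [a xa] [b yb]; exists (a - b); rewrite raddfB /= -xa -yb.
Qed.

HB.instance Definition _ n :=
  GRing.isZmodClosed.Build _ (@coboundaries n) (@coboundaries_zmod_closed n).

Definition cohomology n := Quotient.quot (@coboundaries n).

HB.instance Definition _ n :=
  EqQuotient.copy (cohomology n) (Quotient.quot (@coboundaries n)).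
HB.instance Definition _ n := GRing.Zmodule.on (cohomology n).

Lemma cohomology_eq0 n (x : cocycles n) :
  \pi_(cohomology n) x = 0 <-> is_coboundary (cocycle_val x).
Proof.
have -> : 0 = \pi_(cohomology n) 0 by rewrite [LHS]piE.
rewrite (rwP eqP) -Quotient.idealrBE subr0.
by split=> [/asboolP|xb]; last exact/asboolP.
Qed.

End Cohomology.

Section SteenrodSquares.
Context (R : realType) (X : topologicalType).
Local Notation cochain := (cochain R 'F_2 X).

(* The face of the r-simplex spanned by V, when V has p.+1 vertices: enum V is
   increasing, so this is the order-preserving enumeration of V. *)
Definition face p r (V : {set 'I_r.+1}) : 'I_p.+1 -> 'I_r.+1 :=
  fun k => nth ord0 (enum V) k.

(* The vertices j_0 < ... < j_i of J cut {0, ..., r} into the consecutive blocks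
   {0, ..., j_0}, {j_0, ..., j_1}, ..., {j_i, ..., r}, numbered from 0. A vertex
   v lies in the block numbered #|{j in J | j < v}|, and if v is in J also in
   the next one. These are the unions of the even and of the odd blocks. *)
Definition even_blocks r (J : {set 'I_r.+1}) : {set 'I_r.+1} :=
  [set v : 'I_r.+1 | (v \in J) || ~~ odd #|[set j in J | (j < v)%N]|]%SET.
Definition odd_blocks r (J : {set 'I_r.+1}) : {set 'I_r.+1} :=
  [set v : 'I_r.+1 | (v \in J) || odd #|[set j in J | (j < v)%N]|]%SET.

(* Steenrod's mod 2 cup-i product. Since
   #|even_blocks J| + #|odd_blocks J| = r.+1 + #|J|,
   the sum is empty unless r = p + q - i. *)
Definition cup_i (i r p q : nat) (x : cochain p) (y : cochain q) : cochain r :=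
  fun s => \sum_(J : {set 'I_r.+1} | [&& #|J| == i.+1,
      #|even_blocks J| == p.+1 & #|odd_blocks J| == q.+1])
    x (simplex_pull (@face p r (even_blocks J)) s) *
    y (simplex_pull (@face q r (odd_blocks J)) s).

(* Steenrod's definition of Sq^k on cocycles of degree n: x |-> x cup_(n-k) x,
   and 0 if k > n. *)
Definition Sq_cochain k n (x : cochain n) : cochain (k + n)%N :=
  if (k <= n)%N then cup_i (n - k)%N x x else 0.

End SteenrodSquares.
Arguments Sq_cochain {R X} k {n} x.

Section SquareOne.
Context (R : realType) (X : topologicalType).
Local Notation cochain := (cochain R 'F_2 X).

Lemma card_ltn_ord r (u : 'I_r) : #|[set k : 'I_r | (k < u)%N]%SET| = u.
Proof.
rewrite cardsE -sum1_card.
transitivity (\sum_(0 <= k < r | (k < u)%N) 1)%N; first by rewrite big_mkord.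
by rewrite -(big_nat_widen _ _ _ predT) 1?ltnW // sum_nat_const_nat subn0 muln1.
Qed.

Lemma compl2_blocks r (u v : 'I_r.+1) (J := (~: [set u; v])%SET) : (u < v)%N ->
  (u \in even_blocks J = ~~ odd u) * (v \in even_blocks J = odd v) *
  (u \in odd_blocks J = odd u) * (v \in odd_blocks J = ~~ odd v) *
  (forall w, w != u -> w != v -> (w \in even_blocks J) * (w \in odd_blocks J)).
Proof.
move=> ltuv.
have cu : #|[set j in J | (j < u)%N]%SET| = u.
  rewrite -[RHS]card_ltn_ord; apply: eq_card => k; rewrite !inE.
  by case: ltngtP; rewrite ?andbF // => ku; rewrite andbT -!val_eqE /=; lia.
have cv : #|[set j in J | (j < v)%N]%SET| = v.-1.
  transitivity (#|[set k : 'I_r.+1 | (k < v)%N]%SET :\ u|).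
    apply: eq_card => k; rewrite !inE -!val_eqE /=.
    by case: (ltngtP k v) => hv; case: (ltngtP k u) => hu //=; lia.
  have := cardsD1 u [set k : 'I_r.+1 | (k < v)%N]%SET.
  by rewrite card_ltn_ord inE ltuv; move: #|_| => c; lia.
have ov : odd v.-1 = ~~ odd v by case: (val v) ltuv => //= k _; rewrite negbK.
have uJ : u \in J = false by rewrite !inE eqxx.
have vJ : v \in J = false by rewrite !inE eqxx orbT.
split; first by do !split; rewrite inE ?cu ?cv ?uJ ?vJ /= ?ov ?negbK.
by move=> w wu wv; rewrite !inE (negbTE wu) (negbTE wv).
Qed.

Lemma even_blocks2 r (u v : 'I_r.+1) : (u < v)%N ->
  even_blocks (~: [set u; v]) =
    (if odd u then (if odd v then ~: [set u] else ~: [set u; v])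
     else (if odd v then [set: 'I_r.+1] else ~: [set v]))%SET.
Proof.
move=> lt; have [B Bw] := compl2_blocks lt; apply/setP => w.
have vu : v == u = false by rewrite -val_eqE /= gtn_eqF.
have [->|wu] := eqVneq w u.
  by rewrite B; case: (odd u); case: (odd v); rewrite !inE ?eqxx // eq_sym vu.
have [->|wv] := eqVneq w v.
  by rewrite B; case: (odd u); case: (odd v); rewrite !inE ?eqxx ?vu.
rewrite Bw //; case: (odd u); case: (odd v);
  by rewrite !inE ?(negbTE wu) ?(negbTE wv).
Qed.

Lemma odd_blocks2 r (u v : 'I_r.+1) : (u < v)%N ->
  odd_blocks (~: [set u; v]) =
    (if odd u then (if odd v then ~: [set v] else [set: 'I_r.+1])
     else (if odd v then ~: [set u; v] else ~: [set u]))%SET.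
Proof.
move=> lt; have [B Bw] := compl2_blocks lt; apply/setP => w.
have vu : v == u = false by rewrite -val_eqE /= gtn_eqF.
have [->|wu] := eqVneq w u.
  by rewrite B; case: (odd u); case: (odd v); rewrite !inE ?eqxx // eq_sym vu.
have [->|wv] := eqVneq w v.
  by rewrite B; case: (odd u); case: (odd v); rewrite !inE ?eqxx ?vu.
rewrite Bw //; case: (odd u); case: (odd v);
  by rewrite !inE ?(negbTE wu) ?(negbTE wv).
Qed.

Lemma face_setC1 r (u : 'I_r.+2) : @face r r.+1 (~: [set u])%SET = lift u.
Proof.
have e : enum (~: [set u])%SET = map (lift u) (enum 'I_r.+1).
  apply: (@irr_sorted_eq _ (fun i j : 'I_r.+2 => (i < j)%N)).
  - by move=> a b c; apply: ltn_trans.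
  - by move=> a; rewrite ltnn.
  - rewrite {1}/enum_mem -enumT; apply: sorted_filter.
      by move=> a b c; apply: ltn_trans.
    have := iota_ltn_sorted 0 r.+2; rewrite -val_enum_ord sorted_map.
    by [].
  - rewrite sorted_map.
    have : sorted ltn (map val (enum 'I_r.+1)).
      by rewrite val_enum_ord iota_ltn_sorted.
    rewrite sorted_map; apply: sub_sorted => a b /=.
    by rewrite /bump; case: leqP; case: leqP; lia.
  - move=> w; rewrite mem_enum !inE; apply/idP/mapP => [wu|[k _ ->]].
      have uw : u != w by rewrite eq_sym.
      by have [k -> _] := unlift_some uw; exists k; rewrite ?mem_enum.
    by rewrite eq_sym neq_lift.
apply/funext => k; rewrite /face e (nth_map ord0) ?size_enum_ord //.
by rewrite nth_ord_enum.
Qed.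

Lemma cup_pred n (x : cochain n.+1) (s : singular_simplex R X n.+2) :
  (cup_i n x x : cochain n.+2) s = \sum_(p : 'I_n.+3 * 'I_n.+3 |
     (p.1 < p.2)%N && (odd p.1 == odd p.2))
   x (simplex_pull (lift p.1) s) * x (simplex_pull (lift p.2) s).
Proof.
pose h (p : 'I_n.+3 * 'I_n.+3) := (~: [set p.1; p.2])%SET.
pose g (J : {set 'I_n.+3}) : 'I_n.+3 * 'I_n.+3 :=
  odflt (ord0, ord0) [pick p : 'I_n.+3 * 'I_n.+3 | (p.1 < p.2)%N && (J == h p)].
have cardh (p : 'I_n.+3 * 'I_n.+3) : (p.1 < p.2)%N -> #|h p| = n.+1.
  move=> lt; have := cardsC [set p.1; p.2]%SET.
  by rewrite card_ord cards2 -val_eqE /= (ltn_eqF lt) => -[].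
rewrite /cup_i (reindex_onto h g) /=; last first.
  move=> J /and3P[/eqP cJ _ _].
  have : #|(~: J)%SET| == 2 by rewrite cardsCs finset.setCK cJ card_ord; lia.
  case/cards2P => u [v [uv eJ]].
  rewrite /g; case: pickP => [p /andP[_ /eqP->]//|] /=.
  have eJ' : J = (~: [set u; v])%SET by rewrite -eJ finset.setCK.
  case: (ltngtP u v) => [lt|lt|/val_inj e]; last by rewrite e eqxx in uv.
    by move/(_ (u, v)); rewrite /= lt /h eJ' eqxx.
  by move/(_ (v, u)); rewrite /= lt /h eJ' finset.setUC eqxx.
have hinj (p q : 'I_n.+3 * 'I_n.+3) : (p.1 < p.2)%N -> (q.1 < q.2)%N ->
    h p = h q -> p = q.
  case: p q => [a b] [c d] /= lab lcd /(congr1 (@finset.setC _)).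
  rewrite !finset.setCK => e.
  have := finset.in_set2 a c d; rewrite -e !inE eqxx /= => /esym ac.
  have := finset.in_set2 b c d; rewrite -e !inE eqxx orbT /= => /esym bc.
  move: ac bc; rewrite -!val_eqE /= => ac bc.
  by congr (_, _); apply: val_inj => /=; lia.
have cardC1 (w : 'I_n.+3) : #|(~: [set w])%SET| = n.+2.
  by have := cardsC [set w]; rewrite card_ord cards1 => -[].
have hcond u v : [&& #|h (u, v)| == n.+1, #|even_blocks (h (u, v))| == n.+2
    & #|odd_blocks (h (u, v))| == n.+2] && (g (h (u, v)) == (u, v))
    = (u < v)%N && (odd u == odd v).
  have [lt|nlt] := boolP (u < v)%N; last first.
    apply/negbTE/negP => /andP[/and3P[/eqP cJ _ _]].
    rewrite /g; case: pickP => [p /andP[lt _] /= /eqP e|_ /= /eqP [e1 e2]].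
      by move: nlt; rewrite e /= in lt *; rewrite lt.
    by move: cJ; rewrite -e1 -e2 /h /= finset.setUid cardC1 => -[]; lia.
  have -> : g (h (u, v)) == (u, v).
    rewrite /g; case: pickP => [p /andP[ltp /eqP e]|/(_ (u, v))] /=.
      by apply/eqP/esym; apply: hinj.
    by rewrite lt eqxx.
  have := cardh (u, v) lt; rewrite /h /= => cJ.
  rewrite (even_blocks2 lt) (odd_blocks2 lt) cJ eqxx andbT /=.
  by case: (odd u); case: (odd v); rewrite ?cardC1 ?cJ ?cardsT ?card_ord
    ?eqxx //; lia.
apply: eq_big => [[u v]|[u v]]; rewrite hcond //= => /andP[lt /eqP uv].
rewrite /h /= (even_blocks2 lt) (odd_blocks2 lt) uv.
by case: (odd v); rewrite !face_setC1 // mulrC.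
Qed.

End SquareOne.

(* On a cocycle x of degree at least 1, the cochain Sq^1 x is the Bockstein
   cochain obtained from the lift of x with values 0 and 1 in int. This gives
   that Sq^1 preserves cocycles and passes to cohomology. *)
Section Bockstein.
Context (R : realType) (X : topologicalType).

Definition lift2 n (x : cochain R 'F_2 X n) : cochain R int X n :=
  fun s => (x s : nat)%:Z.
Definition red2 n (w : cochain R int X n) : cochain R 'F_2 X n :=
  fun s => (w s)%:~R.

Lemma lift2K n (x : cochain R 'F_2 X n) : red2 (lift2 x) = x.
Proof. by apply/funext => s; rewrite /red2 /lift2 -pmulrn natr_Zp. Qed.

Lemma coboundary_red2 n (w : cochain R int X n) :
  coboundary (red2 w) = red2 (coboundary w).
Proof.
apply/funext => s; rewrite /coboundary /red2 rmorph_sum.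
by apply: eq_bigr => i _; rewrite rmorphM rmorph_sign.
Qed.

Lemma red2_eq0 n (w : cochain R int X n) : red2 w = 0 ->
  exists v : cochain R int X n, w = v + v.
Proof.
move=> w0; exists (fun s => (w s %/ 2)%Z); apply/funext => s.
have /eqP := congr1 (fun f => f s) w0; rewrite /red2 /=.
rewrite -(@dvdz_pcharf _ 2) ?pchar_Fp // => /divzK e.
change (w s = (w s %/ 2)%Z + (w s %/ 2)%Z).
by move: e; lia.
Qed.

Lemma F2_idem (a : 'F_2) : a * a = a.
Proof. by case: a => [[|[|m]] i] //; apply/val_inj. Qed.

Lemma sum_same_parity n (l : 'I_n -> int) : (forall i, l i * l i = l i) ->
  (\sum_i l i) ^+ 2 + (\sum_(i < n) (-1) ^+ i * l i) ^+ 2 =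
  2 * (\sum_i l i + 2 * \sum_(p : 'I_n * 'I_n |
     (p.1 < p.2)%N && (odd p.1 == odd p.2)) l p.1 * l p.2).
Proof.
move=> ll.
set q := \sum_(p : 'I_n * 'I_n | (p.1 < p.2)%N && _) _.
have -> : \sum_i l i + 2 * q =
    \sum_(p : 'I_n * 'I_n | odd p.1 == odd p.2) l p.1 * l p.2.
  rewrite [RHS](bigID (fun p : 'I_n * 'I_n => (p.1 < p.2)%N)) /=.
  rewrite [X in _ = _ + X](bigID (fun p : 'I_n * 'I_n => (p.2 < p.1)%N)) /=.
  have -> : \sum_(p : 'I_n * 'I_n | (odd p.1 == odd p.2) && (p.1 < p.2)%N)
      l p.1 * l p.2 = q by apply: eq_bigl => p; rewrite andbC.
  have -> : \sum_(p : 'I_n * 'I_n | (odd p.1 == odd p.2) && ~~ (p.1 < p.2)%N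
      && (p.2 < p.1)%N) l p.1 * l p.2 = q.
    rewrite /q (reindex_inj (inv_inj (@swap_pairK _ _))) /=.
    apply: eq_big => [[i j]|[i j] _] /=; last by rewrite mulrC.
    by rewrite eq_sym; case: ltngtP; rewrite ?andbT ?andbF.
  have -> : \sum_(p : 'I_n * 'I_n | (odd p.1 == odd p.2) && ~~ (p.1 < p.2)%N
      && ~~ (p.2 < p.1)%N) l p.1 * l p.2 = \sum_i l i.
    rewrite (reindex_onto (fun i : 'I_n => (i, i)) (fun p => p.1)) /=.
      apply: eq_big => [i|i _]; last exact: ll.
      by rewrite ltnn !eqxx.
    move=> [i j] /= /andP[/andP[_ h1] h2].
    by congr (_, _); apply: val_inj => /=; lia.
  ring.
rewrite !expr2 !big_distrlr !pair_big /= -big_split /= mulr_sumr.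
rewrite [RHS]big_mkcond /=; apply: eq_bigr => [[i j]] _ /=.
rewrite mulrACA -exprD -signr_odd oddD.
by case: (odd i); case: (odd j) => /=; rewrite ?expr1 ?expr0; ring.
Qed.

Lemma Sq1_bockstein n (x : cochain R 'F_2 X n.+1) (w : cochain R int X n.+2) :
  coboundary (lift2 x) = w + w -> Sq_cochain 1 x = red2 w.
Proof.
move=> xw; rewrite /Sq_cochain /= subn1 /=; apply/funext => s.
rewrite cup_pred.
pose l (i : 'I_n.+3) := lift2 x (simplex_pull (lift i) s).
have lK (i : 'I_n.+3) : x (simplex_pull (lift i) s) = (l i)%:~R.
  by rewrite -{1}(lift2K x).
have ll i : l i * l i = l i.
  rewrite /l /lift2; move: (x _) => a; have := ltn_ord a.
  by move: (nat_of_ord a) => [|[|b]].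
have := sum_same_parity ll.
have : \sum_(i < n.+3) (-1) ^+ i * l i = w s + w s.
  exact: (congr1 (fun f => f s) xw).
set D := \sum_(i < n.+3) (-1) ^+ i * l i => Dw.
set T := \sum_(i < n.+3) l i; set q := \sum_(p : 'I_n.+3 * 'I_n.+3 | _) _.
pose o := \sum_(i < n.+3 | odd i) l i.
have TD : T = D + 2 * o.
  rewrite /T /D /o mulr_sumr [X in _ + X]big_mkcond -big_split /=.
  apply: eq_bigr => i _; rewrite -signr_odd.
  by case: (odd i); rewrite ?expr1 ?expr0; ring.
move=> e.
have eq : q = (w s + o) * (w s + o) - (w s + o) + w s * w s.
  move: e; rewrite TD Dw !expr2; move: (w s) q (o) => W Q O e.
  have q4 : 4 * Q = 2 * (W + W + 2 * O + 2 * Q) - 2 * (W + W + 2 * O) by ring.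
  by apply: (@mulfI _ 4) => //; rewrite q4 -e; ring.
transitivity (q%:~R : 'F_2).
  rewrite /q rmorph_sum; apply: eq_bigr => p _.
  by rewrite rmorphM /= -!lK.
rewrite eq !(rmorphD, rmorphM, rmorphN) /= !F2_idem subrr add0r.
by [].
Qed.

Lemma Sq1_cocycle n (x : cochain R 'F_2 X n) : coboundary x = 0 ->
  coboundary (Sq_cochain 1 x) = 0.
Proof.
case: n x => [|n] x x0; first by rewrite /Sq_cochain /= raddf0.
have [|w xw] := @red2_eq0 _ (coboundary (lift2 x)).
  by rewrite -coboundary_red2 lift2K.
rewrite (Sq1_bockstein xw) coboundary_red2.
have := coboundaryK (lift2 x); rewrite xw raddfD /= => ww.
apply/funext => s; have : coboundary w s + coboundary w s = 0.
  exact: (congr1 (fun f => f s) ww).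
by rewrite /red2 => ?; have -> : coboundary w s = 0 by lia.
Qed.

Lemma Sq1_coboundary n (x y : cochain R 'F_2 X n) :
  coboundary x = 0 -> coboundary y = 0 ->
  is_coboundary (x - y) -> is_coboundary (Sq_cochain 1 x - Sq_cochain 1 y).
Proof.
case: n x y => [|n] x y x0 y0.
  by move=> _; exists 0; rewrite /Sq_cochain ltnn subr0 raddf0.
move=> [z xyz].
have [|v xv] := @red2_eq0 _ (coboundary (lift2 x)).
  by rewrite -coboundary_red2 lift2K.
have [|w yw] := @red2_eq0 _ (coboundary (lift2 y)).
  by rewrite -coboundary_red2 lift2K.
have [|u xyu] := @red2_eq0 _ (lift2 x - lift2 y - coboundary (lift2 z)).
  transitivity (red2 (lift2 x) - red2 (lift2 y) - red2 (coboundary (lift2 z))).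
    by apply/funext => s; rewrite /red2 /= !rmorphB.
  by rewrite -coboundary_red2 !lift2K xyz subrr.
rewrite (Sq1_bockstein xv) (Sq1_bockstein yw).
have := congr1 (@coboundary _ _ _ _) xyu.
rewrite raddfB raddfB raddfD /= coboundaryK subr0 xv yw => e.
exists (red2 u); rewrite coboundary_red2; apply/funext => s.
have {}e := congr1 (fun f => f s) e.
have : v s + v s - (w s + w s) = coboundary u s + coboundary u s by exact: e.
move=> {}e; rewrite /red2; have -> : coboundary u s = v s - w s by lia.
by rewrite rmorphB.
Qed.
End Bockstein.

Section SquareOnCohomology.
Context (R : realType) (X : topologicalType).
Local Notation cohomology := (cohomology R 'F_2 X).
Local Notation cocycles := (cocycles R 'F_2 X).

Lemma Sq1_cocycle_pred n (x : cocycles n) :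
  Sq_cochain 1 x \in @cocycle_pred R 'F_2 X n.+1.
Proof. by apply/eqP/Sq1_cocycle/eqP/cocycleP. Qed.

Definition Sq1_cocycles n (x : cocycles n) : cocycles n.+1 :=
  Cocycle (Sq1_cocycle_pred x).

(* The value does not depend on the representative, by Sq1_pi. *)
Definition Sq1 n (c : cohomology n) : cohomology n.+1 :=
  \pi_(cohomology n.+1) (Sq1_cocycles (repr c)).

Lemma Sq1_pi n (x : cocycles n) :
  Sq1 (\pi_(cohomology n) x) = \pi_(cohomology n.+1) (Sq1_cocycles x).
Proof.
apply/eqP; rewrite /Sq1 -Quotient.idealrBE; apply/asboolP => /=.
apply: Sq1_coboundary; try exact/eqP/cocycleP.
have /eqP : repr (\pi_(cohomology n) x) = x %[mod cohomology n].
  by rewrite reprK.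
by rewrite -Quotient.idealrBE => /asboolP.
Qed.

End SquareOnCohomology.

Section SimplicialComplexes.
Implicit Types V W : finType.

(* An element i of V is not required to be a vertex, i.e. [set i] may fail to
   be in K. *)
Definition simplicial_complex V (K : {set {set V}}) : Prop :=
  finset.set0 \in K /\
  (forall s t : {set V}, s \in K -> t \subset s -> t \in K).

Definition full_subcomplex V (K : {set {set V}}) (J : {set V}) :
  {set {set V}} := [set s in K | s \subset J]%SET.

(* K and L are complexes on the vertex sets A and B. *)
Definition simplicial_iso V W (A : {set V}) (K : {set {set V}})
    (B : {set W}) (L : {set {set W}}) : Prop :=
  exists f : V -> W, [/\ {in A &, injective f}, (f @: A = B)%SET &
    forall s : {set V}, s \subset A -> (s \in K) = ((f @: s)%SET \in L)].

Definition P26_facets : seq (seq nat) :=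
  [:: [:: 1; 2; 3]; [:: 1; 2; 6]; [:: 1; 3; 5]; [:: 1; 4; 5]; [:: 1; 4; 6];
      [:: 2; 3; 4]; [:: 2; 4; 5]; [:: 2; 5; 6]; [:: 3; 4; 6]; [:: 3; 5; 6]]%N.

(* The element i of 'I_6 carries the label i.+1. *)
Definition P26 : {set {set 'I_6}} :=
  [set s : {set 'I_6} |
    has (fun F : seq nat => [forall i in s, i.+1 \in F]) P26_facets]%SET.

Lemma P26_complex : simplicial_complex P26.
Proof.
split=> [|s t]; first by rewrite inE /=; apply/orP; left; apply/forall_inP => i;
  rewrite inE.
rewrite !inE => /hasP[F PF /forall_inP sF] /fintype.subsetP ts.
by apply/hasP; exists F => //; apply/forall_inP => i /ts /sF.
Qed.

Definition contains_full V W (K : {set {set V}}) (L : {set {set W}}) : Prop :=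
  exists J : {set V}, simplicial_iso J (full_subcomplex K J) [set: W]%SET L.

End SimplicialComplexes.

Section MomentAngle.
Context (R : realType).

(* D^2 and S^1 are the Euclidean ones: the library's norm on R * R is the
   maximum norm, which is why it is not used. *)
Definition disk : set (R * R) := [set z | z.1 ^+ 2 + z.2 ^+ 2 <= 1].
Definition circle : set (R * R) := [set z | z.1 ^+ 2 + z.2 ^+ 2 = 1].

Definition moment_angle_set m (K : {set {set 'I_m}}) :
    set {ptws 'I_m -> (R * R)%type} :=
  \bigcup_(s in [set` K])
    [set z | forall i : 'I_m, (if i \in s then disk else circle) (z i)].

Definition moment_angle m (K : {set {set 'I_m}}) : topologicalType :=
  set_type (moment_angle_set K).

End MomentAngle.

(* Main.v *)
From HB Require Import structures.
Require Import Defs.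
From mathcomp Require Import all_boot all_order all_algebra.
From mathcomp Require Import zify ring lra.
From mathcomp Require Import all_classical reals topology normedtype sequences realfun.

(* The nonzero square lives in degrees 8 and 9, where H^1(RP^2) and H^2(RP^2)
   contribute to the cohomology of Z_K.

   Let g and h be the indicators of the right and of the upper half plane. As a
   function of pairs of points of the disk, u = g cup dh represents the class of
   the circle, and v = du = dg cup dh vanishes on triples contained in a small
   set that meets the circle. For a set e of the six vertices of P26, take the
   ordered cup product over these vertices of v (at the elements of e) and u (at
   the others), and let x be the sum of these products over the edges e of a
   nontrivial 1-cocycle of RP^2. Then dx is a sum of such products over
   triangles; those in P26 cancel because the edges form a cocycle, the others
   vanish on small tuples, because the coordinates of a point of Z_K that lie
   inside the disk form a simplex.

   So x is only a cocycle on small singular simplices. The value at s of x on the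
   N-th barycentric subdivision of s depends on N, but its limit along a
   nonprincipal ultrafilter on N is a singular cocycle, because the subdivisions
   of a given simplex are eventually small.

   The products of disks (over a simplex of P26) and circles (elsewhere),
   triangulated by shuffles, form chains of Z_K. The sum C over the facets has
   boundary 2D with D a sum over edges, since each edge of RP^2 lies in two
   triangles. D is made of small simplices, so subdivision does not change the
   value of x on D, which is 1. If Sq^1 x, which is the Bockstein of x, were a
   coboundary dy, then x(D) = (dy)(C) = y(2D) = 0 mod 2. *)

Set Implicit Arguments.
Unset Strict Implicit.
Unset Printing Implicit Defensive.

Import Order.TTheory GRing.Theory Num.Theory numFieldNormedType.Exports.
Local Open Scope ring_scope.

(** * Functions of words and shuffle products *)

Section WordCoboundary.
Context {A : comNzRingType} {X : Type}.
Implicit Types (f g : seq X -> A) (w : seq X).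

(* A word stands for the ordered simplex with these vertices, and chains are
   replaced by linear functionals on the functions of words. *)
Definition del i w := take i w ++ drop i.+1 w.

Lemma size_del i w : (i < size w)%N -> size (del i w) = (size w).-1.
Proof. by move=> lt; rewrite size_cat size_take size_drop lt; lia. Qed.

Lemma nth_del x0 i w k : (i < size w)%N -> nth x0 (del i w) k = nth x0 w (bump i k).
Proof.
move=> lt; rewrite nth_cat size_take lt /bump.
case: (ltnP k i) => ki; first by rewrite add0n nth_take.
by rewrite nth_drop; congr nth; lia.
Qed.

(** The simplicial coboundary, in a recursive form that makes inductions on words free of index
    shifts. It is augmented: on a one-letter word its value is [f [::]], which accounts for the
    extra terms and for the conditions on [f [::]] further on. *)
Fixpoint wdiff f w : A :=
  if w is x :: v then f v - wdiff (fun u => f (x :: u)) v else 0.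

Lemma wdiff_cons f x w : wdiff f (x :: w) = f w - wdiff (fun u => f (x :: u)) w.
Proof. by []. Qed.

Lemma wdiffE f w : wdiff f w = \sum_(i < size w) (-1) ^+ i * f (del i w).
Proof.
elim: w f => [|x w IH] f /=; first by rewrite big_ord0.
rewrite big_ord_recl /= IH expr0 mul1r /del /= drop0 -sumrN; congr (_ + _).
by apply: eq_bigr => i _; rewrite exprS mulN1r mulNr.
Qed.

Lemma eq_wdiff_size n f g w : (forall v, size v = n -> f v = g v) ->
  size w = n.+1 -> wdiff f w = wdiff g w.
Proof.
move=> e sw; rewrite !wdiffE; apply: eq_bigr => i _.
by rewrite e // size_del ?sw.
Qed.

Lemma eq_wdiff f g w : f =1 g -> wdiff f w = wdiff g w.
Proof. by move=> e; rewrite !wdiffE; apply: eq_bigr => i _; rewrite e. Qed.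

Lemma wdiffD f g w : wdiff (fun v => f v + g v) w = wdiff f w + wdiff g w.
Proof.
by rewrite !wdiffE -big_split; apply: eq_bigr => i _; rewrite mulrDr.
Qed.

Lemma wdiffM a f w : wdiff (fun v => a * f v) w = a * wdiff f w.
Proof. by rewrite !wdiffE mulr_sumr; apply: eq_bigr => i _; rewrite mulrCA. Qed.

Lemma wdiff_sum I (r : seq I) (P : pred I) (F : I -> seq X -> A) w :
  wdiff (fun v => \sum_(i <- r | P i) F i v) w = \sum_(i <- r | P i) wdiff (F i) w.
Proof.
rewrite wdiffE; under eq_bigr do rewrite mulr_sumr.
by rewrite exchange_big; apply: eq_bigr => i _; rewrite wdiffE.
Qed.

Lemma wdiff0 w : wdiff (fun=> 0) w = 0.
Proof. by rewrite wdiffE big1 // => i _; rewrite mulr0. Qed.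

Lemma wdiffN f w : wdiff (fun v => - f v) w = - wdiff f w.
Proof. by rewrite !wdiffE -sumrN; apply: eq_bigr => i _; rewrite mulrN. Qed.

Lemma wdiff_nilp b a w :
  wdiff (fun v => if nilp v && b then a else 0) w =
  if (size w == 1) && b then a else 0.
Proof.
case: w => [|x [|y w]] //=; first by rewrite subr0.
by rewrite wdiff0 subrr subr0.
Qed.

Lemma wdiffK f w : wdiff (wdiff f) w = 0.
Proof.
elim: w f => [|x w IH] f //=.
have -> : wdiff (fun u => f u - wdiff (fun v => f (x :: v)) u) w = wdiff f w.
  by rewrite wdiffD wdiffN IH oppr0 addr0.
by rewrite subrr.
Qed.

End WordCoboundary.

Section Shuffle.
Context {A : comNzRingType} {X Y Z : eqType} (c : X -> Y -> Z).
Implicit Types (f g : seq Z -> A).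

(* The sum of f over the shuffles of s and t: the monotone lattice paths from the
   first to the last vertex of the product of the two simplices. *)
Fixpoint shuffle (s : seq X) : (seq Z -> A) -> seq Y -> A :=
  if s is x :: s' then
    fix aux f t := if t is y :: t' then
      if nilp s' && nilp t' then f [:: c x y] else
      shuffle s' (fun u => f (c x y :: u)) t +
      (-1) ^+ size s' * aux (fun u => f (c x y :: u)) t'
    else 0
  else fun _ _ => 0.

Lemma shuffle_nill f t : shuffle [::] f t = 0.
Proof. by []. Qed.

Lemma shuffle_nilr s f : shuffle s f [::] = 0.
Proof. by case: s. Qed.

Lemma shuffle_cons x s y t f : shuffle (x :: s) f (y :: t) =
  (if nilp s && nilp t then f [:: c x y] else 0) +
  shuffle s (fun u => f (c x y :: u)) (y :: t) +
  (-1) ^+ size s * shuffle (x :: s) (fun u => f (c x y :: u)) t.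
Proof.
rewrite [LHS]/=; case: ifP => [/andP[/nilP-> /nilP->]|_]; last by rewrite add0r.
by rewrite mulr0 !addr0.
Qed.

Arguments shuffle : simpl never.

Definition in_prod s t (w : seq Z) :=
  size w = (size s + size t).-1 /\
  forall z, z \in w -> exists x y, [/\ x \in s, y \in t & z = c x y].

Lemma in_prod_cons x s y t s' t' w :
  in_prod s' t' w -> {subset s' <= x :: s} -> {subset t' <= y :: t} ->
  (size s' + size t').-1.+1 = (size s + size t).+1 ->
  in_prod (x :: s) (y :: t) (c x y :: w).
Proof.
move=> [sw iw] ss tt e; split; first by rewrite /= sw addnS /= e.
move=> z; rewrite inE => /orP[/eqP->|/iw [x1 [y1 [/ss h1 /tt h2 ->]]]].
  by exists x, y; rewrite !mem_head.
by exists x1, y1.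
Qed.

Lemma eq_shuffle s t f g : (forall w, in_prod s t w -> f w = g w) ->
  shuffle s f t = shuffle s g t.
Proof.
elim: s t f g => [//|x s IHs]; elim=> [|y t IHt] f g e; first by rewrite !shuffle_nilr.
rewrite !shuffle_cons; congr (_ + _ + _ * _).
- case: ifP => // /andP[/nilP s0 /nilP t0]; apply: e; split; first by rewrite s0 t0.
  by move=> z; rewrite inE => /eqP->; exists x, y; rewrite !mem_head.
- apply: IHs => w iw; apply: e; apply: in_prod_cons iw _ _ _ => //.
    by move=> z; rewrite inE orbC => ->.
  by rewrite /= addnS.
- apply: IHt => w iw; apply: e; apply: in_prod_cons iw _ _ _ => //.
  by move=> z; rewrite inE orbC => ->.
Qed.

Lemma shuffleD s t f g : shuffle s (fun w => f w + g w) t = shuffle s f t +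
  shuffle s g t.
Proof.
elim: s t f g => [|x s IHs]; first by move=> *; rewrite /= addr0.
elim=> [|y t IHt] f g; first by rewrite !shuffle_nilr addr0.
rewrite !shuffle_cons IHs IHt; case: ifP => _; ring.
Qed.

Lemma shuffleM a s t f : shuffle s (fun w => a * f w) t = a * shuffle s f t.
Proof.
elim: s t f => [|x s IHs]; first by move=> *; rewrite /= mulr0.
elim=> [|y t IHt] f; first by rewrite !shuffle_nilr mulr0.
rewrite !shuffle_cons IHs IHt; case: ifP => _; ring.
Qed.

Lemma shuffleN s t f : shuffle s (fun w => - f w) t = - shuffle s f t.
Proof.
rewrite -mulN1r -shuffleM; congr (shuffle s _ t).
by apply/boolp.funext => w; rewrite mulN1r.
Qed.

(** The Leibniz rule for the Eilenberg-Zilber product. The last term is the augmentation: for two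
    points, the product is a one-letter word, whose boundary is the empty word. *)
Lemma shuffle_wdiff s t f : shuffle s (wdiff f) t =
  wdiff (fun s' => shuffle s' f t) s + (-1) ^+ (size s).-1 * wdiff (shuffle s f) t +
  (if (size s == 1) && (size t == 1) then f [::] else 0).
Proof.
elim: s t f => [|x s IHs].
  by move=> t f /=; rewrite wdiff0 mulr0 !addr0.
elim=> [|y t IHt] f.
  rewrite shuffle_nilr [wdiff (shuffle _ _) _]/= mulr0 andbF !addr0.
  by rewrite (eq_wdiff (g := fun=> 0)) ?wdiff0 // => u; exact: shuffle_nilr.
set f' := fun u => f (c x y :: u); set e : A := (-1) ^+ size s.
have ee : e * e = 1 by rewrite -expr2 sqrr_sign.
rewrite shuffle_cons.
have -> : (fun u => wdiff f (c x y :: u)) = (fun u => f u + - wdiff f' u).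
  exact/funext.
rewrite !shuffleD !shuffleN IHs IHt -/e.
rewrite !wdiff_cons.
have -> : wdiff (fun s' => shuffle (x :: s') f (y :: t)) s =
    (if (size s == 1) && nilp t then f [:: c x y] else 0) +
    wdiff (fun s' => shuffle s' f' (y :: t)) s +
    (-1) ^+ (size s).-1 * wdiff (fun s' => shuffle (x :: s') f' t) s.
  case: s {IHs IHt e ee} => [|x1 s]; first by rewrite /= mulr0 !addr0.
  (* The sign in [shuffle_cons] depends on the length of the face [s'], so the expansion is made
     only for faces of length [size s]. *)
  rewrite (eq_wdiff_size (n := size s) (g := fun s' => (if nilp s' && nilp t
    then f [:: c x y] else 0) + (shuffle s' f' (y :: t) +
      (-1) ^+ size s * shuffle (x :: s') f' t))) //.
    by rewrite !wdiffD wdiffM wdiff_nilp addrA.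
  by move=> s' <-; rewrite shuffle_cons addrA.
have -> : wdiff (fun t' => shuffle (x :: s) f (y :: t')) t =
    (if (size t == 1) && nilp s then f [:: c x y] else 0) +
    wdiff (fun t' => shuffle s f' (y :: t')) t + e * wdiff (shuffle (x :: s) f') t.
  case: t {IHs IHt} => [|y1 t]; first by rewrite /= mulr0 !addr0.
  rewrite (eq_wdiff_size (n := size t) (g := fun t' => (if nilp t' && nilp s
    then f [:: c x y] else 0) + (shuffle s f' (y :: t') +
      e * shuffle (x :: s) f' t'))) //.
    by rewrite !wdiffD wdiffM wdiff_nilp addrA.
  by move=> t' _; rewrite shuffle_cons addrA andbC.
have -> : (size (x :: s) == 1) = nilp s by case: (s).
have -> : (size (y :: t) == 1) = nilp t by case: (t).
rewrite -/e.
case: s @e ee {IHs IHt} => [|x1 s] e ee.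
  rewrite /e !expr0 /= wdiff0 andbT /f' !shuffle_nill; case: (nilp t);
    case: (size t == 1) => /=; ring.
have -> : (-1) ^+ (size (x1 :: s)).-1 = - e by rewrite /e /= exprS mulN1r opprK.
rewrite [nilp _]/= !andbF /f' /=; case: ifP => _.
  ring: ee.
ring: ee.
Qed.
End Shuffle.
Arguments shuffle : simpl never.

(** * Evaluation of cup products on shuffle products *)

Section NormalizedCup.
Context {A : comNzRingType}.

Definition normalized X (f : seq X -> A) :=
  forall u x v, f (u ++ [:: x, x & v]) = 0.

Lemma normalized_cons X (f : seq X -> A) x :
  normalized f -> normalized (fun v => f (x :: v)).
Proof. by move=> nf u y v; exact: (nf (x :: u)). Qed.

Context {X Y Z : eqType} (c : X -> Y -> Z) (p1 : Z -> X) (p2 : Z -> Y).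
Hypothesis p1c : forall x y, p1 (c x y) = x.
Hypothesis p2c : forall x y, p2 (c x y) = y.

(** A path that moves in the first factor repeats a letter in the second projection, so a normalized
    [b] vanishes on it. Only a one-letter [s] leaves a path without such moves. *)
Lemma shuffle_snd (b : seq Y -> A) s y t : normalized b ->
  shuffle c s (fun w => b (map p2 w)) (y :: t) = if size s == 1 then b (y :: t) else 0.
Proof.
elim: s b y t => [//|x s IHs] b y t; elim: t b y => [|y1 t IHt] b y nb.
  rewrite shuffle_cons shuffle_nilr mulr0 addr0 andbT /= p2c (IHs (fun v =>
    b (y :: v))); last exact: normalized_cons.
  by rewrite (nb [::]) if_same addr0; case: (s).
rewrite shuffle_cons andbF add0r /= p2c (IHs (fun v => b (y :: v)));
  last exact: normalized_cons.
rewrite (nb [::]) if_same add0r (IHt (fun v => b (y :: v)));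
  last exact: normalized_cons.
by case: (s) => [|? ?]; rewrite /= ?mulr0 ?mul1r.
Qed.

Lemma shuffle_cup0 (a : seq X -> A) (b : seq Y -> A) s y t : normalized b ->
  shuffle c s (fun w => a (map p1 (take 1 w)) * b (map p2 w)) (y :: t) =
  if size s == 1 then a s * b (y :: t) else 0.
Proof.
case: s => [//|x s] nb.
have E h : shuffle c h (fun u => a (map p1 (take 1 (c x y :: u))) *
    b (map p2 (c x y :: u))) =1
    (fun r => a [:: x] * shuffle c h (fun u => b (y :: map p2 u)) r).
  by move=> r; rewrite -shuffleM; apply: eq_shuffle => w _; rewrite /= take0 /= p1c p2c.
rewrite shuffle_cons !E /= p1c p2c (@shuffle_snd (fun v => b (y :: v)));
  last exact: normalized_cons.
rewrite (nb [::]) if_same mulr0 addr0.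
case: t => [|y1 t]; first by case: (s) => [|? ?]; rewrite ?shuffle_nilr /= ?mulr0 addr0.
rewrite (@shuffle_snd (fun v => b (y :: v))) ?andbF ?add0r; last exact: normalized_cons.
by case: (s) => [|? ?]; rewrite /= ?mul1r ?mulr0.
Qed.

(* The Alexander-Whitney map is left inverse to the shuffle product. *)
Lemma shuffle_cup k (a : seq X -> A) (b : seq Y -> A) s y t :
  normalized a -> normalized b -> b [::] = 0 ->
  shuffle c s (fun w => a (map p1 (take k.+1 w)) * b (map p2 (drop k w))) (y :: t) =
  if size s == k.+1 then a s * b (y :: t) else 0.
Proof.
move=> na nb b0; elim: s k a y t na => [//|x s IHs] k a y t.
elim: t k a y => [|y1 t IHt] [|k] a y na /=.
- under [X in shuffle _ _ X _]boolp.eq_fun do rewrite drop0; exact: shuffle_cup0.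
- rewrite shuffle_cons shuffle_nilr mulr0 addr0 /= p1c (IHs k (fun v => a (x :: v))) //;
    last exact: normalized_cons.
  by rewrite b0 mulr0 if_same add0r.
- under [X in shuffle _ _ X _]boolp.eq_fun do rewrite drop0; exact: shuffle_cup0.
rewrite shuffle_cons andbF add0r /= p1c (IHs k (fun v => a (x :: v))) //;
  last exact: normalized_cons.
rewrite (IHt k (fun v => a (x :: v))) //; last exact: normalized_cons.
by rewrite (na [::]) mul0r if_same mulr0 addr0.
Qed.
End NormalizedCup.

Lemma addF2 (a : 'F_2) : a + a = 0.
Proof. by case: a => [[|[|m]] i] //; apply/val_inj. Qed.

Lemma oppF2 (a : 'F_2) : - a = a.
Proof. by apply/esym/eqP; rewrite -addr_eq0 addF2. Qed.

Lemma wdiff_consF2 X (f : seq X -> 'F_2) x w :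
  wdiff f (x :: w) = f w + wdiff (fun u => f (x :: u)) w.
Proof. by rewrite wdiff_cons oppF2. Qed.

(** * Barycentric subdivision mod 2 *)

Section Subdivision.
Context {P : eqType} (b : seq P -> P).
Implicit Types (f g : seq P -> 'F_2) (w : seq P).

(* The sum of f over the subdivision of w: the cone with apex the barycenter b w
   over the subdivision of the boundary of w. *)
Fixpoint subdiv n f w : 'F_2 :=
  if n is m.+1 then wdiff (subdiv m (fun u => f (b w :: u))) w else f w.

(** Dual to the chain homotopy T w = b_w (w + T(dw)) between the identity and the subdivision, where
    b_w ( ) is the cone with apex [b w]. *)
Fixpoint subdiv_htpy n f w : 'F_2 := f (b w :: w) +
  if n is m.+1 then wdiff (subdiv_htpy m (fun u => f (b w :: u))) w else 0.

Lemma subdivD n f g w : subdiv n (fun u => f u + g u) w = subdiv n f w + subdiv n g w.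
Proof.
elim: n f g w => [//|n IH] f g w /=; rewrite -wdiffD; apply: eq_wdiff => u.
by rewrite -IH.
Qed.

Lemma subdiv_htpyD n f g w : subdiv_htpy n (fun u => f u + g u) w = subdiv_htpy n f w +
  subdiv_htpy n g w.
Proof.
elim: n f g w => [|n IH] f g w /=; first by rewrite !addr0.
rewrite addrACA; congr (_ + _); rewrite -wdiffD; apply: eq_wdiff => u.
by rewrite -IH.
Qed.

(** The boundary of a cone is its base plus the cone over the boundary of the base. Here the base is
    the subdivision of the boundary of [w], which is a cycle by induction. *)
Lemma subdiv_wdiff n f w : size w = n.+2 -> subdiv n.+1 (wdiff f) w =
  wdiff (subdiv n f) w.
Proof.
elim: n f w => [|n IH] f w sw.
  rewrite /= (eq_wdiff (g := fun u => f u + wdiff (fun v => f (b w :: v)) u)).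
    by rewrite wdiffD wdiffK addr0.
  by move=> u; rewrite oppF2.
change (wdiff (subdiv n.+1 (fun u => wdiff f (b w :: u))) w = wdiff (subdiv n.+1 f) w).
rewrite (@eq_wdiff_size _ _ n.+2 _ (fun u => subdiv n.+1 f u +
    wdiff (subdiv n (fun v => f (b w :: v))) u)) //; last first.
  move=> v sv; rewrite -(IH (fun u => f (b w :: u))) // -subdivD;
    congr (subdiv n.+1 _ v); apply/funext => u.
  exact: wdiff_consF2.
by rewrite wdiffD wdiffK addr0.
Qed.

Lemma subdiv_eq0 n f w : size w = n.+1 ->
  (forall v, size v = n.+1 -> f v = 0) -> subdiv n f w = 0.
Proof.
elim: n f w => [|n IH] f w sw H /=; first exact: H.
rewrite wdiffE big1 // => i _.
by rewrite IH ?mulr0 ?size_del ?sw // => v sv; apply: H; rewrite /= sv.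
Qed.

Lemma subdiv_htpy_eq0 n f w : size w = n.+1 ->
  (forall v, size v = n.+2 -> f v = 0) -> subdiv_htpy n f w = 0.
Proof.
elim: n f w => [|n IH] f w sw H /=; rewrite H /= ?sw ?add0r //.
rewrite wdiffE big1 // => i _.
by rewrite IH ?mulr0 ?size_del ?sw // => v sv; apply: H; rewrite /= sv.
Qed.

Hypothesis b1 : forall x, b [:: x] = x.

(** The homotopy formula dT + Td = 1 + Sd, proved by the cone formula. In dimension 0 the homotopy
    is the degenerate edge from a point to itself, by [b1]. *)
Lemma subdiv_htpyP n f w : size w = n.+1 ->
  subdiv_htpy n (wdiff f) w + (if n is m.+1 then wdiff (subdiv_htpy m f) w else 0) =
    f w + subdiv n f w.
Proof.
elim: n f w => [|n IH] f w sw.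
  case: w sw => [|x [|y w]] //= _; by rewrite b1 !oppF2 !addr0 !addF2.
set f' := fun u => f (b w :: u).
have -> : subdiv_htpy n.+1 (wdiff f) w = f w + wdiff f' w + wdiff (subdiv_htpy n f) w +
    wdiff (subdiv_htpy n (wdiff f')) w.
  rewrite [LHS]/= oppF2 -!addrA; congr (_ + (_ + _)).
  rewrite -wdiffD; apply: eq_wdiff => v; rewrite -subdiv_htpyD;
    congr (subdiv_htpy _ _ _).
  by apply/funext => u; rewrite oppF2.
have -> : subdiv n.+1 f w = wdiff (subdiv n f') w by [].
have E : wdiff (subdiv_htpy n (wdiff f')) w = wdiff f' w + wdiff (subdiv n f') w.
  rewrite -wdiffD; case: n IH sw => [|n] IH sw.
    by apply: (eq_wdiff_size (n := 1%N)) => // v sv; rewrite -IH // addr0.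
  transitivity (wdiff (fun v => subdiv_htpy n.+1 (wdiff f') v +
    wdiff (subdiv_htpy n f') v) w).
    by rewrite (wdiffD (subdiv_htpy n.+1 (wdiff f')) (wdiff (subdiv_htpy n f'))) wdiffK
      addr0.
  by apply: (eq_wdiff_size (n := n.+2)) => // v sv; exact: IH.
rewrite E.
have -> (p q r s : 'F_2) : p + q + r + (q + s) + r = p + s + (q + q) + (r + r).
  by ring.
by rewrite !addF2 !addr0.
Qed.

End Subdivision.

Section Naturality.
Context {P Q : eqType} (b : seq P -> P) (b' : seq Q -> Q) (h : P -> Q).
Hypothesis hb : forall w, w != [::] -> h (b w) = b' (map h w).

Lemma map_del i w : map h (del i w) = del i (map h w).
Proof. by rewrite /del map_cat map_take map_drop. Qed.

Lemma wdiff_map (f : seq Q -> 'F_2) w : wdiff f (map h w) = wdiff (fun v =>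
  f (map h v)) w.
Proof. by elim: w f => //= x w IH f; rewrite IH. Qed.

Lemma subdiv_map n f w : size w = n.+1 ->
  subdiv b' n f (map h w) = subdiv b n (fun u => f (map h u)) w.
Proof.
elim: n f w => [//|n IH] f w sw /=; rewrite wdiff_map;
  apply: (eq_wdiff_size (n := n.+1)) => // v sv.
by rewrite IH //= hb //; case: (w) sw.
Qed.

Lemma subdiv_htpy_map n f w : size w = n.+1 ->
  subdiv_htpy b' n f (map h w) = subdiv_htpy b n (fun u => f (map h u)) w.
Proof.
elim: n f w => [|n IH] f w sw /=; rewrite hb; try by case: (w) sw.
congr (_ + _); rewrite wdiff_map; apply: (eq_wdiff_size (n := n.+1)) => // v sv.
by rewrite IH //= hb //; case: (w) sw.
Qed.

End Naturality.

(** * The mesh of a barycentric subdivision *)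

Section Mesh.
Context {R : realFieldType} {I : Type} {P : eqType} (b : seq P -> P).
Variable co : I -> P -> R.
Hypothesis co_b : forall k w, w != [::] ->
  (size w)%:R * co k (b w) = \sum_(p <- w) co k p.

Definition diam_le (d : R) (w : seq P) :=
  forall k p q, p \in w -> q \in w -> `|co k p - co k q| <= d.

Definition bary_closed (C : P -> Prop) :=
  forall w, w != [::] -> (forall p, p \in w -> C p) -> C (b w).

(** A substitute for the convex hull of [w]: only closure under [b] is ever required, and balls have
    it. *)
Definition in_hull (w v : seq P) := forall C, bary_closed C ->
  (forall p, p \in w -> C p) -> forall p, p \in v -> C p.

Lemma ball_bary_closed x d : bary_closed (fun p => forall k, `|x k - co k p| <= d).
Proof.
move=> w w0 H k.
have sw : 0 < (size w)%:R :> R by case: (w) w0 => // *; rewrite ltr0n.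
rewrite -(ler_pM2l sw) -{1}(gtr0_norm sw) -normrM mulrBr co_b //.
have -> : (size w)%:R * x k = \sum_(p <- w) x k.
  by rewrite big_const_seq count_predT iter_addr_0 mulr_natl.
rewrite -sumrB; apply: le_trans (ler_norm_sum _ _ _) _.
have -> : (size w)%:R * d = \sum_(p <- w) d.
  by rewrite big_const_seq count_predT iter_addr_0 mulr_natl.
by rewrite big_seq [X in _ <= X]big_seq; apply: ler_sum => p pw; exact: H.
Qed.

(** The difference is the mean of n.+1 differences of letters, of which the one of [q] with itself
    is 0; hence the factor n / n.+1. *)
Lemma bary_dist n d w : size w = n.+1 -> diam_le d w ->
  forall q, q \in w -> forall k, `|co k (b w) - co k q| <= n%:R / n.+1%:R * d.
Proof.
move=> sw dw q qw k.
have n0 : 0 < n.+1%:R :> R by rewrite ltr0n.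
rewrite mulrAC -(ler_pM2l n0) mulrC [X in _ <= X]mulrC divfK ?gt_eqF //.
rewrite mulrC -{1}(gtr0_norm n0) -normrM mulrBr -sw co_b ?sw; last by case: (w) sw.
have -> : n.+1%:R * co k q = \sum_(p <- w) co k q.
  by rewrite big_const_seq count_predT iter_addr_0 mulr_natl sw.
rewrite -sumrB; apply: le_trans (ler_norm_sum _ _ _) _.
rewrite (perm_big _ (perm_to_rem qw)) big_cons /= subrr normr0 add0r.
have -> : n%:R * d = \sum_(p <- rem q w) d.
  by rewrite big_const_seq count_predT iter_addr_0 mulr_natl size_rem // sw.
rewrite big_seq [X in _ <= X]big_seq; apply: ler_sum => p /mem_rem pw; exact: dw.
Qed.

Lemma mem_del i (w : seq P) p : p \in del i w -> p \in w.
Proof. by rewrite mem_cat => /orP[/mem_take|/mem_drop]. Qed.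

(** An edge of the subdivision either comes from the subdivision of a face, where the factor is no
    larger, or joins [b w] to a point of the hull of a face. The latter lies in the ball about [b w]
    given by [bary_dist], because balls are closed under barycenters. *)
Lemma subdiv_eq0_fine n (f : seq P -> 'F_2) d w : size w = n.+1 -> 0 <= d ->
  diam_le d w ->
  (forall v, size v = n.+1 -> diam_le (n%:R / n.+1%:R * d) v -> in_hull w v ->
    f v = 0) ->
  subdiv b n f w = 0.
Proof.
elim: n f w => [|n IH] f w sw d0 dw H.
  apply: H => //; last by move=> C _.
  case: w sw dw => [|x [|]] // _ _ k p q; rewrite !inE => /eqP-> /eqP->.
  by rewrite subrr normr0 !mul0r.
rewrite /= wdiffE big1 // => i _.
have si : size (del i w) = n.+1 by rewrite size_del // sw.
have w0 : w != [::] by case: (w) sw.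
rewrite IH ?mulr0 // => [k p q /mem_del hp /mem_del hq|v sv dv hv]; first exact: dw.
have le_r : n%:R / n.+1%:R * d <= n.+1%:R / n.+2%:R * d :> R.
  rewrite ler_wpM2r // ler_pdivrMr ?ltr0n // mulrAC ler_pdivlMr ?ltr0n //.
  by rewrite -!natrM ler_nat; lia.
have bv p k : p \in v -> `|co k (b w) - co k p| <= n.+1%:R / n.+2%:R * d.
  move=> pv; move: (hv _ (@ball_bary_closed (fun k => co k (b w)) _)
    (fun p pw => bary_dist sw dw (mem_del pw)) p pv k).
  exact.
apply: H; first by rewrite /= sv.
  move=> k p q; rewrite !inE => /orP[/eqP->|pv] /orP[/eqP->|qv].
  - by rewrite subrr normr0 mulr_ge0 // divr_ge0.
  - exact: bv.
  - by rewrite distrC; exact: bv.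
  - exact: le_trans (dv _ _ _ pv qv) le_r.
move=> C cC Cw p; rewrite inE => /orP[/eqP->|pv]; first exact: cC.
by apply: (hv C) => // q /mem_del; exact: Cw.
Qed.

End Mesh.

(** * Products of local cochains and of cells *)

Section LocalCochains.
Context {X : eqType} (x0 : X) (g h : X -> 'F_2).
Implicit Types (m : seq bool) (w : seq (seq X)).

(* The cup products g cup dh and dg cup dh. *)
Definition local1 (w : seq X) : 'F_2 :=
  if w is [:: p; q] then g p * (h p + h q) else 0.
Definition local2 (w : seq X) : 'F_2 :=
  if w is [:: p; q; r] then (g p + g q) * (h q + h r) else 0.
Definition local_cochain (b : bool) := if b then local2 else local1.

(** The ordered cup product over the coordinates. The factor [local_cochain b] has degree b.+1 and
    reads b.+2 vertices, the last of which is shared with the next factor. The empty product is the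
    unit cochain of degree 0. *)
Fixpoint cup_word m w : 'F_2 :=
  if m is b :: m' then
    local_cochain b (map (head x0) (take b.+2 w)) * cup_word m' (map behead (drop b.+1
      w))
  else (size w == 1)%:R.

Definition deg m := sumn (map (fun b : bool => b.+1) m).

Lemma normalized_local b : normalized (local_cochain b).
Proof.
case: b => -[|a [|c u]] x [|d [|e v]];
  rewrite /local_cochain /= ?addF2 ?mulr0 ?mul0r //.
all: by case: u => [|? [|? ?]].
Qed.

Lemma normalized_cup_word m : normalized (cup_word m).
Proof.
elim: m => [|b m IH] u x v /=; first by rewrite size_cat addnC.
have [le|lt] := leqP (size u).+2 b.+2.
  rewrite take_cat ltnNge (leq_trans (leqnSn _) (leq_trans (leqnSn _) le)) /=.
  have -> : (b.+2 - size u = (b - size u).+2)%N by lia.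
  by rewrite /= map_cat /= normalized_local mul0r.
rewrite drop_cat; case: ltnP => [ltb|geb].
  by rewrite map_cat /= IH mulr0.
have -> : (b.+1 - size u = 0)%N by lia.
by rewrite drop0 /= (IH [::]) mulr0.
Qed.

(** On the right-hand side, the last face in the first summand and the first face in the second one
    both give [a (take k.+1 w) * c (drop k.+1 w)], and they cancel mod 2. *)
Lemma wdiff_cup (a c : seq (seq X) -> 'F_2) k w : (k.+2 <= size w)%N ->
  wdiff (fun v => a (take k.+1 v) * c (drop k v)) w =
  wdiff a (take k.+2 w) * c (drop k.+1 w) + a (take k.+1 w) * wdiff c (drop k w).
Proof.
elim: k a w => [|k IH] a [|x w] //= sw.
  case: w sw => [//|y w] _ /=; rewrite !oppF2 !take0 /= !addr0 wdiffM.
  set p := a _; set q := c _; set r := a _; set s := c _; set d := wdiff _ _.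
  have -> : (p + r) * q + r * (q + (s + d)) = p * q + (r * s + r * d) + (r * q + r * q).
    by ring.
  by rewrite addF2 addr0.
rewrite (IH (fun u => a (x :: u))) // !oppF2 mulrDl addrA.
by congr (_ + _).
Qed.

(* The terms of the coboundary mod 2: each factor local1 in turn becomes local2,
   its coboundary. *)
Fixpoint raise_mask m : seq (seq bool) :=
  if m is b :: m' then
    (if b then [::] else [:: true :: m']) ++ map (cons b) (raise_mask m')
  else [::].

Lemma wdiff_local (b : bool) (w : seq X) : size w = b.+3 -> wdiff (local_cochain b) w =
  if b then 0 else local_cochain true w.
Proof.
case: b; case: w => [|p [|q [|r w]]] //; rewrite /local_cochain /=.
  case: w => [|s [|]] //= _; rewrite !oppF2 !addr0.
  move: (g p) (g q) (g r) (h q) (h r) (h s) => a b c e k l.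
  have -> : (b + c) * (k + l) + ((a + c) * (k + l) + ((a + b) * (e + l) + (a +
    b) * (e + k)))
    = (a + b) * (e + e) + (a + a) * (k + l) + (b + b) * (k + l) + (c + c) * (k +
      l) by ring.
  by rewrite !addF2 !mulr0 !mul0r !addr0.
case: w => [|] //= _; rewrite !oppF2 !addr0.
move: (g p) (g q) (h p) (h q) (h r) => a b e k l.
have -> : b * (k + l) + (a * (e + l) + a * (e + k)) = (a + b) * (k + l) + a * (e +
  e) by ring.
by rewrite addF2 mulr0 addr0.
Qed.

Lemma wdiff_cup_word m w : size w = (deg m).+2 -> wdiff (cup_word m) w =
  \sum_(t <- raise_mask m) cup_word t w.
Proof.
elim: m w => [|b m IH] w sw.
  by case: w sw => [|x [|y [|]]] //= _; rewrite big_nil oppF2 subr0 addF2.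
have sw' : size w = (b.+2 + (deg m).+1)%N by rewrite sw /deg /= addnS.
rewrite (_ : wdiff (cup_word (b :: m)) w = wdiff (fun v =>
    (fun u => local_cochain b (map (head x0) u)) (take b.+2 v) *
    (fun u => cup_word m (map behead u)) (drop b.+1 v)) w) //.
have sw2 : (b.+3 <= size w)%N by rewrite sw'; lia.
rewrite (wdiff_cup (fun u => local_cochain b (map (head x0) u)) (fun u =>
  cup_word m (map behead u)) sw2).
rewrite -!wdiff_map wdiff_local; last by rewrite size_map size_takel // sw'; lia.
rewrite IH; last by rewrite size_map size_drop sw'; lia.
rewrite /= big_cat big_map /= mulr_sumr; congr (_ + _).
by case: b {sw sw' sw2}; rewrite ?big_nil ?mul0r ?big_seq1.
Qed.

(** The factor at [k] is [local2], a difference of values of [g] times a difference of values of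
    [h]. *)
Lemma cup_word_const m w k : nth false m k ->
  (forall y z, y \in w -> z \in w -> g (nth x0 y k) = g (nth x0 z k)) \/
  (forall y z, y \in w -> z \in w -> h (nth x0 y k) = h (nth x0 z k)) ->
  cup_word m w = 0.
Proof.
elim: m w k => [|b m IH] w k; first by rewrite nth_nil.
case: k => [|k] /= bk H; last first.
  rewrite (IH _ k bk) ?mulr0 //; case: H => H; [left|right].
    move=> y z /mapP[y1 /mem_drop y1w ->] /mapP[z1 /mem_drop z1w ->].
    by rewrite !nth_behead; exact: H.
  move=> y z /mapP[y1 /mem_drop y1w ->] /mapP[z1 /mem_drop z1w ->].
  by rewrite !nth_behead; exact: H.
rewrite bk /=; case: w H => [|p [|q [|r w]]] //= H; rewrite ?mul0r //.
rewrite take0 /=; rewrite -!nth0; case: H => H.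
  by rewrite (H p q) ?inE ?eqxx ?orbT // addF2 !mul0r.
by rewrite (H q r) ?inE ?eqxx ?orbT // addF2 mulr0 !mul0r.
Qed.

End LocalCochains.

(** * Product chains of disks and circles *)

Section ProductChains.
Context {A : comNzRingType} {X : eqType} (x0 : X) (o i : 'I_4 -> X).

Definition ev_chain {Y : Type} (c : seq (bool * seq Y)) (f : seq Y -> A) : A :=
  \sum_(p <- c) (-1) ^+ p.1 * f p.2.

Lemma ev_chainD Y (c : seq (bool * seq Y)) f f' :
  ev_chain c (fun w => f w + f' w) = ev_chain c f + ev_chain c f'.
Proof. by rewrite /ev_chain -big_split; apply: eq_bigr => p _; rewrite mulrDr. Qed.

Lemma ev_chainM Y (c : seq (bool * seq Y)) a f : ev_chain c (fun w => a * f w) =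
  a * ev_chain c f.
Proof. by rewrite /ev_chain mulr_sumr; apply: eq_bigr => p _; rewrite mulrCA. Qed.

Lemma eq_ev_chain (Y : eqType) (c : seq (bool * seq Y)) f f' :
  (forall p, p \in c -> f p.2 = f' p.2) -> ev_chain c f = ev_chain c f'.
Proof. by move=> e; apply: eq_big_seq => p /e ->. Qed.

Definition sides : seq (bool * ('I_4 * 'I_4)) :=
  [:: (false, (inord 0, inord 1)); (false, (inord 1, inord 2));
      (false, (inord 2, inord 3)); (true, (inord 0, inord 3))].

(* The square with corners o, triangulated as an annulus around the square with
   corners i, which is a union of two triangles. The orientation of the fourth
   side makes the faces inside the square cancel without permuting vertices. *)
Definition circ : seq (bool * seq X) :=
  [seq (p.1, [:: o p.2.1; o p.2.2]) | p <- sides].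
Definition disc : seq (bool * seq X) :=
  [seq (p.1, [:: i p.2.1; o p.2.1; o p.2.2]) | p <- sides] ++
  [seq (~~ p.1, [:: i p.2.1; i p.2.2; o p.2.2]) | p <- sides] ++
  [:: (false, [:: i (inord 0); i (inord 1); i (inord 2)]);
      (false, [:: i (inord 0); i (inord 2); i (inord 3)])].
Definition cell (b : bool) := if b then disc else circ.

Lemma ev_disc f : ev_chain disc (wdiff f) = ev_chain circ f.
Proof. by rewrite /ev_chain !(big_cat, big_map, big_cons, big_nil) /=; ring. Qed.

Lemma ev_circ f : ev_chain circ (wdiff f) = 0.
Proof. by rewrite /ev_chain !(big_cat, big_map, big_cons, big_nil) /=; ring. Qed.

Lemma size_cell b p : p \in cell b -> size p.2 = b.+2.
Proof.
case: b; rewrite /cell /disc /circ ?mem_cat.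
  by case/or3P => [/mapP[q _ ->]|/mapP[q _ ->]|] //; rewrite !inE => /orP[] /eqP->.
by case/mapP => q _ ->.
Qed.

(** The value of [f] on the iterated shuffle product of the cells chosen by [m]. A letter is a point
    of the product, given as the list of its coordinates; the empty product is a single point, the
    empty list. *)
Fixpoint prod_cell (m : seq bool) (f : seq (seq X) -> A) : A :=
  if m is b :: m' then ev_chain (cell b) (fun s => prod_cell m' (shuffle cons s f))
  else f [:: [::]].

Lemma prod_cellD m f f' : prod_cell m (fun w => f w + f' w) = prod_cell m f +
  prod_cell m f'.
Proof.
elim: m f f' => //= b m IH f f'; rewrite -ev_chainD; apply: eq_ev_chain => p _.
by rewrite -IH; congr prod_cell; apply/funext => t; rewrite shuffleD.
Qed.

Lemma prod_cellM m a f : prod_cell m (fun w => a * f w) = a * prod_cell m f.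
Proof.
elim: m f => //= b m IH f; rewrite -ev_chainM; apply: eq_ev_chain => p _.
by rewrite -IH; congr prod_cell; apply/funext => t; rewrite shuffleM.
Qed.

Lemma prod_cell0 m : prod_cell m (fun=> 0) = 0.
Proof. by have := prod_cellM m 0 (fun=> 0); rewrite !mul0r. Qed.

Lemma prod_cell_wdiff_comm m (Y : Type) (F : seq Y -> seq (seq X) -> A) s :
  prod_cell m (fun t => wdiff (fun s' => F s' t) s) = wdiff (fun s' =>
    prod_cell m (F s')) s.
Proof.
elim: s F => [|x s IH] F /=.
  exact: prod_cell0.
rewrite -(IH (fun u => F (x :: u))) -mulN1r -prod_cellM -prod_cellD.
by congr prod_cell; apply/funext => t; rewrite mulN1r.
Qed.

(** In each coordinate all letters are vertices of one simplex of the cell, so that convexity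
    controls the whole affine simplex spanned by [w]. *)
Fixpoint supported (m : seq bool) (w : seq (seq X)) : Prop :=
  if m is b :: m' then
    (exists2 p, p \in cell b & forall z, z \in w -> head x0 z \in p.2) /\
    supported m' (map behead w)
  else True.

Lemma supported_sub m w w' : {subset w' <= w} -> supported m w -> supported m w'.
Proof.
elim: m w w' => //= b m IH w w' ww [[p pb pw] sw]; split.
  by exists p => // z /ww; exact: pw.
by apply: IH sw => z /mapP[y /ww yw ->]; apply: map_f.
Qed.

Definition in_prod_cell m w :=
  [/\ size w = (deg m).+1, supported m w & forall z, z \in w -> size z = size m].

Lemma eq_prod_cell m f f' : (forall w, in_prod_cell m w -> f w = f' w) ->
  prod_cell m f = prod_cell m f'.
Proof.
elim: m f f' => [|b m IH] f f' H /=.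
  by apply: H; split=> // z; rewrite inE => /eqP->.
apply: eq_ev_chain => p pb; apply: IH => t [st supt szt]; apply: eq_shuffle =>
  w [sw iw].
apply: H; split.
- by rewrite sw st (size_cell pb) /deg /= addnS.
- split.
    by exists p => // z /iw[x [y [xp _ ->]]].
  by apply: supported_sub supt => z /mapP[z' /iw[x [y [_ yt ->]]] ->].
- by move=> z /iw[x [y [_ yt ->]]]; rewrite /= (szt _ yt).
Qed.

(** The cellular boundary: each disk in turn becomes its bounding circle. Passing a circle, which
    has odd dimension, changes the sign. *)
Fixpoint bd_mask (m : seq bool) : seq (bool * seq bool) :=
  if m is b :: m' then
    (if b then [:: (false, false :: m')] else [::]) ++
    [seq (~~ b (+) p.1, b :: p.2) | p <- bd_mask m']
  else [::].

Lemma prod_cell_wdiff m f : f [::] = 0 ->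
  prod_cell m (wdiff f) = \sum_(p <- bd_mask m) (-1) ^+ p.1 * prod_cell p.2 f.
Proof.
elim: m f => [|b m IH] f f0; first by rewrite /= f0 subr0 big_nil.
have E p : p \in cell b -> prod_cell m (shuffle cons p.2 (wdiff f)) =
    wdiff (fun s => prod_cell m (shuffle cons s f)) p.2 +
    (-1) ^+ (~~ b) * \sum_(q <- bd_mask m) (-1) ^+ q.1 * prod_cell q.2 (shuffle cons
      p.2 f).
  move=> pb; rewrite -IH ?shuffle_nilr // -prod_cell_wdiff_comm -prod_cellM -prod_cellD.
  congr prod_cell; apply/funext => t; rewrite shuffle_wdiff (size_cell pb) /= addr0.
  by congr (_ + _ * _); case: (b); rewrite ?expr1 ?expr0 // sqrrN expr1n.
rewrite [LHS]/= (eq_ev_chain (f' := fun s => wdiff (fun s =>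
  prod_cell m (shuffle cons s f)) s +
    (-1) ^+ (~~ b) * \sum_(q <- bd_mask m) (-1) ^+ q.1 * prod_cell q.2 (shuffle cons s
      f))) //.
rewrite ev_chainD ev_chainM big_cat big_map; congr (_ + _).
  by case: (b); rewrite ?ev_circ ?ev_disc ?big_nil // big_seq1 mul1r.
rewrite [ev_chain _ _](_ : _ =
  \sum_(q <- bd_mask m) (-1) ^+ q.1 * ev_chain (cell b) (fun s =>
    prod_cell q.2 (shuffle cons s f))).
  by rewrite mulr_sumr; apply: eq_bigr => q _; rewrite mulrA signr_addb.
rewrite /ev_chain; under eq_bigr do rewrite mulr_sumr.
by rewrite exchange_big; apply: eq_bigr => q _; rewrite mulr_sumr;
  apply: eq_bigr => p _; rewrite mulrCA.
Qed.

End ProductChains.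

Section Evaluation.
Context {X : eqType} (x0 : X) (o i : 'I_4 -> X) (g h : X -> 'F_2).
Hypothesis ev_circ_local : ev_chain (circ o) (local_cochain g h false) = 1.

(** On the disk this is Stokes' formula, as [local2] is the coboundary of [local1]. *)
Lemma ev_cell_local b : ev_chain (cell o i b) (local_cochain g h b) = 1.
Proof.
case: b => //; rewrite -ev_circ_local -(ev_disc o i); apply: eq_ev_chain => p.
by move/(@size_cell _ _ _ true) => sp; rewrite wdiff_local.
Qed.

(** Product cells and cup products are dual bases: [shuffle_cup] splits the pairing into one factor
    per coordinate, which is 1 if the degrees agree and 0 otherwise. *)
Lemma prod_cell_cup m m' : size m = size m' ->
  prod_cell o i m (cup_word x0 g h m') = (m == m')%:R.
Proof.
elim: m m' => [|b m IH] [|b' m'] //= [sm].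
pose F (s : seq X) (t : seq (seq X)) :=
  (b == b')%:R * local_cochain g h b' s * cup_word x0 g h m' t.
transitivity (ev_chain (cell o i b) (fun s => prod_cell o i m (F s))).
  apply: eq_ev_chain => p pb; apply: (eq_prod_cell (x0 := x0)) => -[|y t] [//] _ _ _.
  rewrite (shuffle_cup (p1 := head x0) (p2 := behead)) //.
  - rewrite (size_cell pb) /F !eqSS.
    by case: (b); case: (b'); rewrite /= ?mul1r ?mul0r.
  - exact: normalized_local.
  - exact: normalized_cup_word.
  - by case: (m') => [|b1 m1] //=; case: b1; rewrite mul0r.
transitivity ((b == b')%:R * ev_chain (cell o i b) (local_cochain g h b') * (m ==
  m')%:R).
  rewrite mulrC -!ev_chainM; apply: eq_ev_chain => p pb.
  by rewrite prod_cellM IH // mulrC.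
rewrite eqseq_cons; case: eqP => [<-|_]; last by rewrite !mul0r.
by rewrite ev_cell_local !mul1r.
Qed.

End Evaluation.

(** * Edges and triangles of the six-vertex projective plane *)

Definition mask_of (F : seq nat) : seq bool := [seq k.+1 \in F | k <- iota 0 6].
Definition facet_masks := map mask_of P26_facets.
Definition is_face (t : seq bool) :=
  has (fun F : seq nat => all (fun k => nth false t k ==> (k.+1 \in F)) (iota 0 6))
    P26_facets.

Lemma is_faceE t : is_face t = ([set k : 'I_6 | nth false t k]%SET \in P26).
Proof.
rewrite inE; apply: eq_has => F; apply/allP/forall_inP => H k.
  by rewrite inE => tk; have := H k; rewrite mem_iota tk; apply; exact: ltn_ord.
rewrite mem_iota => /andP[_ k6]; apply/implyP => tk.
by have := H (Ordinal k6); rewrite inE; exact.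
Qed.

(* cocycle_edges generates H^1(RP^2; F_2), and cycle_edges is half the boundary
   of the sum of the product cells over the facets. *)
Definition cocycle_edges : seq (seq bool) :=
  map mask_of [:: [:: 1; 2]; [:: 1; 3]; [:: 2; 6]; [:: 3; 5]; [:: 5; 6]]%N.
Definition cycle_edges : seq (bool * seq bool) :=
  [seq (p.1, mask_of p.2) | p <- [:: (false, [:: 1; 3]); (false, [:: 1; 6]);
     (true, [:: 3; 4]); (false, [:: 4; 6])]]%N.

(** Each edge lies in two facets, whose contributions cancel or agree. They agree exactly for the
    four edges of [cycle_edges]. *)
Lemma sum_bd_facets (A : comNzRingType) (P : seq bool -> A) :
  \sum_(m <- facet_masks) \sum_(p <- bd_mask m) (-1) ^+ p.1 * P p.2 =
  2 * \sum_(p <- cycle_edges) (-1) ^+ p.1 * P p.2.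
Proof.
rewrite /facet_masks /cycle_edges /mask_of !(big_map, big_cons, big_nil) /=.
ring.
Qed.

Lemma sum_bd_cycle (A : comNzRingType) (P : seq bool -> A) :
  \sum_(p <- cycle_edges) (-1) ^+ p.1 *
    (\sum_(q <- bd_mask p.2) (-1) ^+ q.1 * P q.2) = 0.
Proof.
rewrite /cycle_edges /mask_of !(big_map, big_cons, big_nil) /=.
ring.
Qed.

Lemma raise_cocycle_sum (F : seq bool -> 'F_2) :
  (forall t, size t = 6%N -> ~~ is_face t -> F t = 0) ->
  \sum_(e <- cocycle_edges) \sum_(t <- raise_mask e) F t = 0.
Proof.
move=> F0; rewrite -(big_map raise_mask xpredT (fun r =>
  \sum_(t <- r) F t)) -big_flatten.
set L := flatten _.
have s6 : all (fun t => size t == 6%N) L by [].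
pose U := undup [seq t <- L | is_face t].
rewrite (bigID is_face) /= [X in _ + X]big1_seq ?addr0; last first.
  by move=> t /andP[nt tL]; apply: F0 => //; apply/eqP/(allP s6).
(* The cocycle condition: every triangle of [P26] that contains an edge of [cocycle_edges] contains
   exactly two of them. *)
rewrite -big_filter (perm_big (U ++ U)); first by rewrite big_cat; exact: addF2.
by vm_compute.
Qed.

(** The only common edge is {1,3}. *)
Lemma cocycle_cycle :
  \sum_(p <- cycle_edges) (-1) ^+ p.1 *
    (\sum_(e <- cocycle_edges) (p.2 == e)%:R) = 1 :> 'F_2.
Proof.
rewrite /cocycle_edges /cycle_edges /mask_of !(big_map, big_cons, big_nil) /=.
exact/val_inj.
Qed.

(** Three disks and three circles give degree 3 * 2 + 3 = 9; for an edge, two disks and four circles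
    give 2 * 2 + 4 = 8. *)
Lemma size_facet_masks m : m \in facet_masks -> [/\ size m = 6%N, deg m =
  9%N & is_face m].
Proof.
move=> mf; suff /allP/(_ _ mf) /and3P[/eqP ? /eqP ? ?] :
  all (fun m => [&& size m == 6%N, deg m == 9%N & is_face m]) facet_masks by [].
by [].
Qed.

Lemma size_cycle_edges p : p \in cycle_edges ->
  [/\ size p.2 = 6%N, deg p.2 = 8%N & is_face p.2].
Proof.
move=> mf; suff /allP/(_ _ mf) /and3P[/eqP ? /eqP ? ?] :
  all (fun p => [&& size p.2 == 6%N, deg p.2 == 8%N & is_face p.2]) cycle_edges by [].
by [].
Qed.

Lemma size_cocycle_edges e : e \in cocycle_edges -> size e = 6%N /\ deg e = 8%N.
Proof.
move=> me; suff /allP/(_ _ me) /andP[/eqP ? /eqP ?] :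
  all (fun e => (size e == 6%N) && (deg e == 8%N)) cocycle_edges by [].
by [].
Qed.

Local Open Scope classical_set_scope.

Section SubdivisionExtensionality.
Context {P : eqType} (b : seq P -> P).

Lemma eq_subdiv_size n (f g : seq P -> 'F_2) w : (forall v, size v = n.+1 -> f v =
  g v) ->
  size w = n.+1 -> subdiv b n f w = subdiv b n g w.
Proof.
elim: n f g w => [|n IH] f g w e sw; first exact: e.
apply: (@eq_wdiff_size _ _ n.+1) => // v sv; apply: IH => // u su.
by apply: e; rewrite /= su.
Qed.

Lemma eq_subdiv_htpy_size n (f g : seq P -> 'F_2) w : (forall v, size v = n.+2 -> f v =
  g v) ->
  size w = n.+1 -> subdiv_htpy b n f w = subdiv_htpy b n g w.
Proof.
elim: n f g w => [|n IH] f g w e sw /=; rewrite e ?sw //=; first by rewrite sw.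
  congr (_ + _); apply: (@eq_wdiff_size _ _ n.+1) => // v sv; apply: IH => // u su.
  by apply: e; rewrite /= su.
by rewrite sw.
Qed.
End SubdivisionExtensionality.

(** * Subdivision of singular simplices *)

Section AffineSimplices.
Context {R : realType}.
Implicit Types n k : nat.

Definition coord n (t : std_simplex R n) (i : 'I_n.+1) : R := (\val t : 'I_n.+1 -> R) i.

Lemma coord_ge0 n (t : std_simplex R n) i : 0 <= coord t i.
Proof. by case: t => t /= tS; have [H _] := set_mem tS; exact: H. Qed.

Lemma coord_sum n (t : std_simplex R n) : \sum_i coord t i = 1.
Proof. by case: t => t /= tS; have [_ H] := set_mem tS; exact: H. Qed.

Lemma coord_inj n (t u : std_simplex R n) : coord t =1 coord u -> t = u.
Proof. by move=> e; apply/val_inj/funext => i; exact: e. Qed.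

Lemma mk_simplexP n (f : 'I_n.+1 -> R) : (forall i, 0 <= f i) -> \sum_i f i = 1 ->
  (f : {ptws 'I_n.+1 -> R}) \in @std_simplex_set R n.
Proof. by move=> f0 f1; apply/mem_set. Qed.

Definition mk_simplex n (f : 'I_n.+1 -> R) (f0 : forall i, 0 <= f i)
  (f1 : \sum_i f i = 1) : std_simplex R n :=
  exist (fun u => u \in @std_simplex_set R n) _ (mk_simplexP f0 f1).

Lemma vert_ge0 n (i j : 'I_n.+1) : 0 <= (j == i)%:R :> R.
Proof. exact: ler0n. Qed.
Lemma vert_sum n (i : 'I_n.+1) : \sum_j (j == i)%:R = 1 :> R.
Proof. by rewrite (bigD1 i) //= eqxx big1 ?addr0 // => j /negPf ->. Qed.
Definition vert n (i : 'I_n.+1) : std_simplex R n :=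
  mk_simplex (vert_ge0 i) (vert_sum i).
Definition verts n : seq (std_simplex R n) := [seq vert i | i <- enum 'I_n.+1].

Lemma size_verts n : size (verts n) = n.+1.
Proof. by rewrite size_map size_enum_ord. Qed.

Lemma nth_verts n d (i : 'I_n.+1) : nth d (verts n) i = vert i.
Proof. by rewrite (nth_map ord0) ?size_enum_ord // nth_ord_enum. Qed.

Section Aff.
Context {n k : nat} (w : seq (std_simplex R n)).

Definition aff_coef (t : std_simplex R k) (j : 'I_n.+1) : R :=
  \sum_(i < k.+1) coord t i * coord (nth (vert ord0) w i) j.

Lemma aff_ge0 t j : 0 <= aff_coef t j.
Proof. by apply: sumr_ge0 => i _; rewrite mulr_ge0 // coord_ge0. Qed.

Lemma aff_sum t : \sum_j aff_coef t j = 1.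
Proof.
rewrite exchange_big /= -(coord_sum t); apply: eq_bigr => i _.
by rewrite -mulr_sumr coord_sum mulr1.
Qed.

Definition aff_fun (t : std_simplex R k) : std_simplex R n :=
  mk_simplex (aff_ge0 t) (aff_sum t).

Lemma coord_continuous m (i : 'I_m.+1) : continuous (fun t : std_simplex R m =>
  coord t i).
Proof.
move=> t; apply: (@continuous_comp _ _ _ set_val
  (fun u : {ptws 'I_m.+1 -> R} => u i)); first exact: initial_continuous.
exact: (@proj_continuous _ (fun=> R : topologicalType)).
Qed.

Lemma aff_continuous : continuous aff_fun.
Proof.
apply: continuous_comp_initial; apply: ptws_continuous => j.
apply: continuous_big => [|i _]; first exact: add_continuous.
move=> t; exact: (cvgM (@coord_continuous k i t) (cvg_cst _)).
Qed.

HB.instance Definition _ := @isContinuous.Build _ _ aff_fun aff_continuous.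

Definition aff : continuousType (std_simplex R k) (std_simplex R n) := aff_fun.

End Aff.

Section Bary.
Context {n : nat}.
Definition bary_coef (w : seq (std_simplex R n)) (j : 'I_n.+1) : R :=
  if w is [::] then (j == ord0)%:R else (\sum_(p <- w) coord p j) / (size w)%:R.

Lemma bary_ge0 w j : 0 <= bary_coef w j.
Proof.
case: w => [|p w]; first exact: ler0n.
by apply: divr_ge0 => //; apply: sumr_ge0 => q _; exact: coord_ge0.
Qed.

Lemma bary_sum w : \sum_j bary_coef w j = 1.
Proof.
case: w => [|p w]; first exact: vert_sum.
rewrite -mulr_suml exchange_big /=.
under eq_bigr do rewrite coord_sum.
by rewrite big_const_seq count_predT iter_addr_0 divff ?pnatr_eq0.
Qed.

Definition bary (w : seq (std_simplex R n)) : std_simplex R n :=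
  mk_simplex (bary_ge0 w) (bary_sum w).

Lemma coord_bary j w : w != [::] ->
  (size w)%:R * coord (bary w) j = \sum_(p <- w) coord p j.
Proof. by case: w => // p w _; rewrite /coord /= mulrC divfK ?pnatr_eq0. Qed.

Lemma bary1 p : bary [:: p] = p.
Proof. by apply: coord_inj => j; rewrite /coord /= big_seq1 divr1. Qed.

End Bary.

Lemma aff_bary n k (w : seq (std_simplex R n)) (v : seq (std_simplex R k)) :
  v != [::] -> aff w (bary v) = bary (map (aff w) v).
Proof.
move=> v0; apply: coord_inj => j.
have sv : (size v)%:R != 0 :> R by rewrite pnatr_eq0 size_eq0.
apply: (mulfI sv); rewrite -[in RHS](size_map (aff w)) coord_bary; last by case: (v) v0.
rewrite big_map /coord /= /aff_coef mulr_sumr exchange_big; apply: eq_bigr => i _ /=.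
by rewrite mulrA coord_bary // mulr_suml.
Qed.

Lemma aff_aff n k l (w : seq (std_simplex R n)) (v : seq (std_simplex R k))
  (t : std_simplex R l) : size v = l.+1 -> aff w (aff v t) = aff (map (aff w) v) t.
Proof.
move=> sv; apply: coord_inj => j; rewrite /coord /= /aff_coef.
transitivity (\sum_(i < k.+1) \sum_(a < l.+1)
    coord t a * coord (nth (vert ord0) v a) i * coord (nth (vert ord0) w i) j).
  by apply: eq_bigr => i _; rewrite -mulr_suml.
rewrite exchange_big; apply: eq_bigr => a _ /=.
rewrite (nth_map (vert ord0)) ?sv // /coord /= mulr_sumr; apply: eq_bigr => i _.
by rewrite mulrA.
Qed.

Lemma aff_verts n (t : std_simplex R n) : aff (verts n) t = t.
Proof.
apply: coord_inj => j; rewrite /coord /= /aff_coef (bigD1 j) //= nth_verts {2}/coord /=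
  eqxx.
rewrite mulr1 big1 ?addr0 // => i /negPf ij.
by rewrite nth_verts {2}/coord /= eq_sym ij mulr0.
Qed.

Lemma aff_vert n k (w : seq (std_simplex R n)) (i : 'I_k.+1) :
  aff w (vert i) = nth (vert ord0) w i.
Proof.
apply: coord_inj => j; rewrite {1}/coord /= /aff_coef (bigD1 i) //= {1}/coord /= eqxx
  mul1r.
by rewrite big1 ?addr0 // => a /negPf ai; rewrite {1}/coord /= ai mul0r.
Qed.

Lemma map_aff_verts n k (w : seq (std_simplex R n)) : size w = k.+1 ->
  map (aff w) (verts k) = w.
Proof.
move=> sw; apply: (@eq_from_nth _ (vert ord0)) => [|i].
  by rewrite size_map size_verts.
rewrite size_map size_verts => ik; rewrite (nth_map (vert ord0)) ?size_verts //.
by rewrite (nth_verts _ (Ordinal ik)) aff_vert.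
Qed.

Lemma aff_lift n k (w : seq (std_simplex R n)) (i : 'I_k.+2) (t : std_simplex R k) :
  size w = k.+2 -> aff w (simplex_map R (lift i) t) = aff (del i w) t.
Proof.
move=> sw; apply: coord_inj => j; rewrite /coord /= /aff_coef.
transitivity (\sum_(a < k.+2) \sum_(c < k.+1 | lift i c == a)
    coord t c * coord (nth (vert ord0) w a) j).
  by apply: eq_bigr => a _; rewrite -mulr_suml.
rewrite (exchange_big_dep xpredT) //=; apply: eq_bigr => c _.
by rewrite (big_pred1 (lift i c)) ?nth_del ?sw // => a; rewrite eq_sym.
Qed.

End AffineSimplices.

Section SingularSubdivision.
Context {R : realType} {X : topologicalType}.
Implicit Types n k : nat.

(** Turns a word of points of the standard simplex into a singular simplex of [X], so that a cochain
    becomes a function of words and the results on words apply. *)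
Definition pull_aff n k (s : singular_simplex R X n) (w : seq (std_simplex R n)) :
  singular_simplex R X k := s \o aff w.
Arguments pull_aff {n} k s w.

Lemma pull_aff_verts n (s : singular_simplex R X n) : pull_aff n s (verts n) = s.
Proof. by apply/continuousEP => t /=; rewrite aff_verts. Qed.

Lemma pull_aff_aff n k l (s : singular_simplex R X n) w (v : seq (std_simplex R k)) :
  size v = l.+1 -> pull_aff l (pull_aff k s w) v = pull_aff l s (map (aff w) v).
Proof. by move=> sv; apply/continuousEP => t /=; rewrite aff_aff. Qed.

Lemma pull_aff_lift n k (s : singular_simplex R X n) w (i : 'I_k.+2) :
  size w = k.+2 -> simplex_pull (lift i) (pull_aff k.+1 s w) = pull_aff k s (del i w).
Proof. by move=> sw; apply/continuousEP => t /=; rewrite aff_lift. Qed.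

Lemma pull_aff_coboundary (A : comNzRingType) n k (z : cochain R A X k)
    (s : singular_simplex R X n) w : size w = k.+2 ->
  coboundary z (pull_aff k.+1 s w) = wdiff (fun v => z (pull_aff k s v)) w.
Proof.
by move=> sw; rewrite wdiffE sw; apply: eq_bigr => i _; rewrite pull_aff_lift.
Qed.

Definition sing_subdiv n (z : cochain R 'F_2 X n) : cochain R 'F_2 X n :=
  fun s => subdiv bary n (fun w => z (pull_aff n s w)) (verts n).

Definition sing_htpy n (y : cochain R 'F_2 X n.+1) : cochain R 'F_2 X n :=
  fun s => subdiv_htpy bary n (fun w => y (pull_aff n.+1 s w)) (verts n).

Lemma sing_subdiv_pull n k (z : cochain R 'F_2 X k) (s : singular_simplex R X n) w :
  size w = k.+1 -> sing_subdiv z (pull_aff k s w) = subdiv bary k (fun v =>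
    z (pull_aff k s v)) w.
Proof.
move=> sw; rewrite -{2}(map_aff_verts sw).
rewrite (subdiv_map (b := bary)) ?size_verts //; last exact: aff_bary.
by apply: eq_subdiv_size; rewrite ?size_verts // => v sv; rewrite pull_aff_aff.
Qed.

Lemma sing_htpy_pull n k (z : cochain R 'F_2 X k.+1) (s : singular_simplex R X n) w :
  size w = k.+1 ->
  sing_htpy z (pull_aff k s w) = subdiv_htpy bary k (fun v => z (pull_aff k.+1 s v)) w.
Proof.
move=> sw; rewrite -{2}(map_aff_verts sw).
rewrite (subdiv_htpy_map (b := bary)) ?size_verts //; last exact: aff_bary.
by apply: eq_subdiv_htpy_size; rewrite ?size_verts // => v sv; rewrite pull_aff_aff.
Qed.

Lemma coboundary_verts (A : comNzRingType) n (z : cochain R A X n) s :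
  coboundary z s = wdiff (fun v => z (pull_aff n s v)) (verts n.+1).
Proof. by rewrite -pull_aff_coboundary ?size_verts // pull_aff_verts. Qed.

Lemma coboundary_subdiv n (z : cochain R 'F_2 X n) :
  coboundary (sing_subdiv z) = sing_subdiv (coboundary z).
Proof.
apply/funext => s; rewrite coboundary_verts.
rewrite (eq_wdiff_size (n := n.+1) (g := subdiv bary n (fun v => z (pull_aff n s v))));
  rewrite ?size_verts //; last by move=> v sv; rewrite sing_subdiv_pull.
rewrite -subdiv_wdiff ?size_verts //; apply: eq_subdiv_size; rewrite ?size_verts // =>
  v sv.
by rewrite pull_aff_coboundary.
Qed.

Lemma sing_htpyP n (z : cochain R 'F_2 X n.+1) :
  z + sing_subdiv z = sing_htpy (coboundary z) + coboundary (sing_htpy z).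
Proof.
apply/funext => s; change (z s + sing_subdiv z s = sing_htpy (coboundary z) s +
  coboundary (sing_htpy z) s).
have := subdiv_htpyP bary1 (fun w => z (pull_aff n.+1 s w)) (size_verts n.+1).
rewrite pull_aff_verts => <-; congr (_ + _).
  apply: eq_subdiv_htpy_size; rewrite ?size_verts // => v sv.
  by rewrite pull_aff_coboundary.
rewrite coboundary_verts; apply: (eq_wdiff_size (n := n.+1)); rewrite ?size_verts //.
by move=> v sv; rewrite sing_htpy_pull.
Qed.

(** Each subdivision multiplies the mesh by at most k / k.+1. *)
Lemma iter_subdiv_eq0 N n k (y : cochain R 'F_2 X k) (s : singular_simplex R X n) d w :
  size w = k.+1 -> 0 <= d -> diam_le (fun i t => coord t i) d w ->
  (forall v, size v = k.+1 -> diam_le (fun i t =>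
    coord t i) ((k%:R / k.+1%:R) ^+ N * d) v ->
     y (pull_aff k s v) = 0) ->
  iter N (@sing_subdiv k) y (pull_aff k s w) = 0.
Proof.
elim: N d w => [|N IH] d w sw d0 dw H /=.
  by apply: H => //; rewrite expr0 mul1r.
rewrite sing_subdiv_pull //; apply: (subdiv_eq0_fine (co := fun i t =>
  coord t i) (@coord_bary R n) sw d0 dw).
move=> v sv dv _; apply: (IH _ v sv _ dv).
  by rewrite mulr_ge0 // divr_ge0.
by move=> u su; rewrite mulrA -exprSr; exact: H.
Qed.

End SingularSubdivision.

(** * Compactness of simplices and Lebesgue's number lemma *)

Section Lebesgue.
Context {R : realType}.

Lemma nbhs_ptws n (x : {ptws 'I_n -> R}) (U : set {ptws 'I_n -> R}) : nbhs x U ->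
  exists2 e : R, 0 < e & forall p, (forall k, `|x k - p k| < e) -> U p.
Proof.
pose F : set_system {ptws 'I_n -> R} := filter_from [set e : R | 0 < e]
  (fun e => [set p | forall k, `|x k - p k| < e]).
have FF : Filter F.
  apply: filter_from_filter; first by exists 1; exact: ltr01.
  move=> d e d0 e0; exists (Num.min d e); first by rewrite /= lt_min d0 e0.
  by move=> p xp; split=> k; have := xp k; rewrite lt_min => /andP[].
suff Fx : F --> x by move=> /Fx [e e0 eU]; exists e.
apply/cvg_sup => i A [B [[V oV <-] Vx] VA].
have /nbhs_ballP[e e0 eV] : nbhs (x i) V by exact: open_nbhs_nbhs.
by exists e => // p xp; apply: VA; apply: eV; exact: xp.
Qed.

Lemma nbhs_simplex n (x : std_simplex R n) (U : set (std_simplex R n)) :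
  nbhs x U ->
  exists2 e : R, 0 < e & forall p, (forall k, `|coord x k - coord p k| < e) -> U p.
Proof.
move=> [B [[V oV <-] Vx] VU].
have [e e0 eV] : exists2 e : R, 0 < e & forall p : {ptws 'I_n.+1 -> R},
    (forall k, `|coord x k - p k| < e) -> V p.
  by apply: nbhs_ptws; exact: open_nbhs_nbhs.
by exists e => // p xp; apply: VU; apply: eV.
Qed.

Lemma std_simplex_compact n : compact (@std_simplex_set R n).
Proof.
apply: (@subclosed_compact _ _ [set f : {ptws 'I_n.+1 -> R} | forall i, `[0,
  1]%classic (f i)]).
- have -> : @std_simplex_set R n =
    \bigcap_(i : 'I_n.+1) [set t : {ptws 'I_n.+1 -> R} | 0 <= t i] `&`
    [set t | \sum_(i < n.+1) t i = 1].
    by apply/seteqP; split=> t [t0 t1]; split=> // i *; exact: t0.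
  apply: closedI.
    apply: closed_bigI => i _.
    apply: (@preimage_closed _ _ (fun t : {ptws 'I_n.+1 -> R} => t i) [set u | 0 <= u]).
      by move=> t _; exact: (@proj_continuous _ (fun=> R : topologicalType)).
    exact: closed_ge.
  apply: (@preimage_closed _ _ (fun t : {ptws 'I_n.+1 -> R} =>
    \sum_(i < n.+1) t i) [set u | u = 1]).
    move=> t _; apply: continuous_big => [|i _]; first exact: add_continuous.
    exact: (@proj_continuous _ (fun=> R : topologicalType)).
  exact: closed_eq.
- exact: (@tychonoff _ (fun=> R : topologicalType) _ (fun=> @segment_compact R 0 1)).
- move=> t [t0 t1] i /=; rewrite in_itv /= t0 /= -t1 (bigD1 i) //= lerDl.
  exact: sumr_ge0.
Qed.

(** [W] is a notion of smallness. By compactness, one [N] serves for the boxes of radius [r ^+ N]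
    about all points, and the affine simplex on [v] lies in such a box about its first letter, by
    convexity. *)
Lemma simplex_lebesgue n k (r : R) (W : set (std_simplex R n) -> Prop) :
  0 <= r -> r < 1 ->
  (forall x : std_simplex R n, exists2 U : set (std_simplex R n), nbhs x U & W U) ->
  (forall U V, V `<=` U -> W U -> W V) ->
  \forall N \near \oo, forall v : seq (std_simplex R n), size v = k.+1 ->
    diam_le (fun i t => coord t i) (r ^+ N) v -> W (range (aff (k := k) v)).
Proof.
move=> r0 r1 Wx WS.
have /compact_near_coveringP C := @std_simplex_compact n.
pose P (N : nat) (x : {ptws 'I_n.+1 -> R}) :=
  W [set p : std_simplex R n | forall i, `|x i - coord p i| <= r ^+ N].
have : \forall N \near \oo, @std_simplex_set R n `<=` P N.
  apply: C => x Sx.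
  have [U] := Wx (exist (fun u => u \in @std_simplex_set R n) x (mem_set Sx)).
  move=> /nbhs_simplex[e e0 eU] WU.
  (* One half for the move from [x] to [x'], the other for the radius of the box about [x']. *)
  have e2 : 0 < e / 2 by rewrite divr_gt0.
  have near_x : \forall x' \near x, forall i, `|x i - x' i| < e / 2.
    apply: (@filter_forall _ _ (fun i => [set x' : {ptws 'I_n.+1 -> R} |
      `|x i - x' i| < e / 2]) _ (nbhs_filter x)) => i.
    have /(_ x) := @proj_continuous _ (fun=> R : topologicalType) i.
    by move/(_ (ball (x i) (e / 2))); apply; exact: nbhsx_ballx.
  have near_r : \forall N \near \oo, r ^+ N < e / 2.
    have : `|r| < 1 by rewrite ger0_norm.
    move=> /cvg_expr/cvgrPdist_lt/(_ _ e2); apply: filterS => N.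
    by rewrite sub0r normrN ger0_norm // exprn_ge0.
  near=> x' N.
  apply: WS WU => p /= xp; apply: eU => i.
  rewrite -(subrKA (x' i)) (splitr e) (le_lt_trans (ler_normD _ _)) // ltrD //.
    by move: i; near: x'.
  by apply: le_lt_trans (xp i) _; near: N.
apply: filterS => N SP [//|p0 v] sv dv.
have Sp0 : @std_simplex_set R n (\val p0) by case: (p0) => p pS; exact: set_mem.
apply: WS (SP _ Sp0) => _ [t _ <-] i /=.
change (`|coord p0 i - coord (aff (p0 :: v) t) i| <= r ^+ N).
rewrite -[coord p0 i]mul1r -(coord_sum t) mulr_suml {2}/coord /= /aff_coef -sumrB.
apply: le_trans (ler_norm_sum _ _ _) _.
rewrite -[r ^+ N]mul1r -(coord_sum t) mulr_suml; apply: ler_sum => a _.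
rewrite -mulrBr normrM ger0_norm ?coord_ge0 // ler_wpM2l ?coord_ge0 //.
by apply: dv; rewrite ?mem_head // mem_nth // sv.
Unshelve. all: by end_near. Qed.

End Lebesgue.

(** * Singular simplices of the moment-angle complex *)

Section Plane.
Context {R : realType}.
Implicit Types p q : R * R.

Definition nsq p : R := p.1 ^+ 2 + p.2 ^+ 2.

Definition rad p : R := Num.sqrt (Num.max 1 (nsq p)).

(* The radial retraction of the plane onto the unit disk. *)
Definition retr p : R * R := (p.1 / rad p, p.2 / rad p).

Lemma rad_gt0 p : 0 < rad p.
Proof. by rewrite sqrtr_gt0 lt_max ltr01. Qed.

Lemma nsq_retr p : nsq (retr p) = nsq p / Num.max 1 (nsq p).
Proof.
rewrite /nsq /retr /= !expr_div_n -mulrDl; congr (_ / _).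
by rewrite sqr_sqrtr // le_max ler01.
Qed.

Lemma retr_disk p : disk (retr p).
Proof.
rewrite /disk /=; change (nsq (retr p) <= 1); rewrite nsq_retr.
by rewrite ler_pdivrMr ?lt_max ?ltr01 // mul1r le_max lexx orbT.
Qed.

Lemma retr_circle p : 1 <= nsq p -> circle (retr p).
Proof.
move=> p1; rewrite /circle /=; change (nsq (retr p) = 1); rewrite nsq_retr.
by rewrite (max_idPr _) // divff // gt_eqF // (lt_le_trans ltr01).
Qed.

Lemma nsq_retr_lt1 p : nsq p < 1 -> nsq (retr p) < 1.
Proof. by move=> p1; rewrite nsq_retr (max_idPl _) ?divr1 // ltW. Qed.

Lemma retr0 : retr 0 = 0.
Proof. by rewrite /retr /= !mul0r. Qed.

Lemma fst_continuous : continuous (fun p : R * R => p.1).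
Proof. by move=> p; exact: cvg_fst. Qed.

Lemma snd_continuous : continuous (fun p : R * R => p.2).
Proof. by move=> p; exact: cvg_snd. Qed.

Lemma pair_continuous (T : topologicalType) (u v : T -> R) :
  continuous u -> continuous v -> continuous (fun t => (u t, v t)).
Proof. by move=> uc vc t; exact: (cvg_pair (uc t) (vc t)). Qed.

Lemma nsq_continuous : continuous nsq.
Proof.
move=> p; apply: cvgD; rewrite expr2.
  exact: (cvgM (@fst_continuous p) (@fst_continuous p)).
exact: (cvgM (@snd_continuous p) (@snd_continuous p)).
Qed.

Lemma rad_continuous : continuous rad.
Proof.
move=> p; apply: (@continuous_comp _ _ _ (fun p => Num.max 1 (nsq p)) Num.sqrt).
  apply: (@continuous_max _ _ (fun=> 1) nsq); first exact: cvg_cst.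
  exact: nsq_continuous.
exact: sqrt_continuous.
Qed.

Lemma retr_continuous : continuous retr.
Proof.
have rV p : (rad q)^-1 @[q --> p] --> (rad p)^-1.
  by apply: cvgV; [rewrite gt_eqF // rad_gt0 | exact: rad_continuous].
apply: pair_continuous => p.
  exact: (cvgM (@fst_continuous p) (rV p)).
exact: (cvgM (@snd_continuous p) (rV p)).
Qed.

Definition in_right p : 'F_2 := ((0 < p.1)%R)%:R.
Definition in_upper p : 'F_2 := ((0 < p.2)%R)%:R.

Lemma in_right_retr p : in_right (retr p) = in_right p.
Proof. by rewrite /in_right /retr /= pmulr_lgt0 // invr_gt0 rad_gt0. Qed.

Lemma in_upper_retr p : in_upper (retr p) = in_upper p.
Proof. by rewrite /in_upper /retr /= pmulr_lgt0 // invr_gt0 rad_gt0. Qed.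

(** The sides of this square avoid the open unit disk, so [retr] carries them to the circle. *)
Definition corner (k : 'I_4) : R * R :=
  nth 0 [:: (1, 1); (-1, 1); (-1, -1); (1, -1)] k.
Definition icorner (k : 'I_4) : R * R := ((corner k).1 / 2, (corner k).2 / 2).

(** Only the right side contributes: it starts in the right half plane and crosses the horizontal
    axis. *)
Lemma ev_circ_corner : ev_chain (circ corner) (local_cochain in_right in_upper false) =
  1.
Proof.
rewrite /ev_chain /circ /sides !(big_map, big_cons, big_nil) /= /corner !inordK //=.
by rewrite /in_right /in_upper /= !ltr01 !ltr0N1; exact/val_inj.
Qed.

Lemma circ_side (e : bool * seq (R * R)) : e \in circ corner ->
  exists2 c : R, c ^+ 2 = 1 &
    (forall q, q \in e.2 -> q.1 = c) \/ (forall q, q \in e.2 -> q.2 = c).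
Proof.
rewrite /circ /sides /= /corner !inE !inordK //=.
have one : (1 : R) ^+ 2 = 1 by rewrite expr1n.
have mone : (-1 : R) ^+ 2 = 1 by rewrite sqrrN expr1n.
by case/or4P => /eqP-> /=; [exists 1 => //; right | exists (-1) => //; left
  | exists (-1) => //; right | exists 1 => //; left] => q;
  rewrite !inE => /orP[] /eqP ->.
Qed.

(** The alternatives foreshadow those of [small]: the first four fix the sign of a coordinate, and
    the inner square lies in the open disk. *)
Lemma cell_small b (e : bool * seq (R * R)) : e \in cell corner icorner b ->
  [\/ forall q, q \in e.2 -> 2^-1 <= q.1,
      forall q, q \in e.2 -> q.1 <= - 2^-1,
      forall q, q \in e.2 -> 2^-1 <= q.2 |
      forall q, q \in e.2 -> q.2 <= - 2^-1] \/
  forall q, q \in e.2 ->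
    [&& - 2^-1 <= q.1, q.1 <= 2^-1, - 2^-1 <= q.2 & q.2 <= 2^-1].
Proof.
have S (w : seq (R * R)) :
    [|| all (fun q => 2^-1 <= q.1) w, all (fun q => q.1 <= - 2^-1) w,
        all (fun q => 2^-1 <= q.2) w, all (fun q => q.2 <= - 2^-1) w |
        all (fun q => [&& - 2^-1 <= q.1, q.1 <= 2^-1,
          - 2^-1 <= q.2 & q.2 <= 2^-1]) w] ->
  [\/ forall q, q \in w -> 2^-1 <= q.1,
      forall q, q \in w -> q.1 <= - 2^-1,
      forall q, q \in w -> 2^-1 <= q.2 |
      forall q, q \in w -> q.2 <= - 2^-1] \/
  forall q, q \in w ->
    [&& - 2^-1 <= q.1, q.1 <= 2^-1, - 2^-1 <= q.2 & q.2 <= 2^-1].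
  by case/or4P=> [/allP ?|/allP ?|/allP ?|/orP[/allP ?|/allP ?]];
    [left; constructor 1|left; constructor 2|left; constructor 3|
     left; constructor 4|right].
move=> eb; apply: S; move: e eb; apply/allP.
have H : ((2^-1 <= 1 :> R) = true) * ((1 <= - 2^-1 :> R) = false) *
    ((2^-1 <= -1 :> R) = false) * ((-1 <= - 2^-1 :> R) = true) *
    ((2^-1 <= 1 / 2 :> R) = true) * ((1 / 2 <= 2^-1 :> R) = true) *
    ((-1 / 2 <= - 2^-1 :> R) = true) * ((- 2^-1 <= -1 / 2 :> R) = true) *
    ((1 / 2 <= - 2^-1 :> R) = false) * ((2^-1 <= -1 / 2 :> R) = false) *
    ((- 2^-1 <= 1 / 2 :> R) = true) * ((-1 / 2 <= 2^-1 :> R) = true).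
  by do !split; try (apply/negbTE; rewrite -ltNge); lra.
case: b; rewrite /cell /disc /circ /sides /icorner /corner /= !inordK //=;
  by rewrite !H /= ?orbT.
Qed.

End Plane.

Section AffinePoints.
Context {R : realType}.
Local Notation point := (seq (R * R)).

Definition aff_point k (w : seq point) (t : std_simplex R k) (b : nat) : R * R :=
  (\sum_(a < k.+1) coord t a * (nth 0 (nth [::] w a) b).1,
   \sum_(a < k.+1) coord t a * (nth 0 (nth [::] w a) b).2).

Lemma aff_point_continuous k w b : continuous (fun t : std_simplex R k =>
  aff_point w t b).
Proof.
by apply: pair_continuous; apply: continuous_big => [|a _];
  [exact: add_continuous | move=> t;
    exact: (cvgM (@coord_continuous R k a t) (cvg_cst _))
  |exact: add_continuous | move=> t;
    exact: (cvgM (@coord_continuous R k a t) (cvg_cst _))].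
Qed.

Lemma aff_point_vert k w b (a : 'I_k.+1) : aff_point w (vert a) b =
  nth 0 (nth [::] w a) b.
Proof.
have E (u : 'I_k.+1 -> R) : \sum_c coord (vert a) c * u c = u a.
  rewrite (bigD1 a) //= {1}/coord /= eqxx mul1r big1 ?addr0 // => c /negPf ca.
  by rewrite {1}/coord /= ca mul0r.
by rewrite /aff_point !E; case: nth.
Qed.

Lemma aff_point_lift k w b (i : 'I_k.+2) (t : std_simplex R k) : size w = k.+2 ->
  aff_point w (simplex_map R (lift i) t) b = aff_point (del i w) t b.
Proof.
move=> sw.
have E (u : nat -> R) : \sum_(a < k.+2) coord (simplex_map R (lift i) t) a * u a =
    \sum_(c < k.+1) coord t c * u (lift i c).
  transitivity (\sum_(a < k.+2) \sum_(c < k.+1 | lift i c == a) coord t c * u a).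
    by apply: eq_bigr => a _; rewrite -mulr_suml.
  rewrite (exchange_big_dep xpredT) //=; apply: eq_bigr => c _.
  by rewrite (big_pred1 (lift i c)) // => a; rewrite eq_sym.
rewrite /aff_point (E (fun a => (nth 0 (nth [::] w a) b).1)).
rewrite (E (fun a => (nth 0 (nth [::] w a) b).2)).
by congr (_, _); apply: eq_bigr => c _; rewrite nth_del ?sw.
Qed.

Lemma coord_sum_ge k (t : std_simplex R k) (u : 'I_k.+1 -> R) lo :
  (forall a, lo <= u a) -> lo <= \sum_a coord t a * u a.
Proof.
move=> H; rewrite -[lo]mul1r -(coord_sum t) mulr_suml; apply: ler_sum => a _.
by rewrite ler_wpM2l ?coord_ge0.
Qed.

Lemma coord_sum_le k (t : std_simplex R k) (u : 'I_k.+1 -> R) hi :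
  (forall a, u a <= hi) -> \sum_a coord t a * u a <= hi.
Proof.
move=> H; rewrite -[hi]mul1r -(coord_sum t) mulr_suml; apply: ler_sum => a _.
by rewrite ler_wpM2l ?coord_ge0.
Qed.

End AffinePoints.

Section MomentAngleSimplices.
Context {R : realType} {m : nat} (K : {set {set 'I_m}}) (vtx : 'I_6 -> 'I_m).
Hypothesis K0 : finset.set0 \in K.
Hypothesis vtx_inj : injective vtx.
Hypothesis vtxK : forall s : {set 'I_6}, ((vtx @: s)%SET \in K) = (s \in P26).
Local Notation Z := (moment_angle R K).
Local Notation point := (seq (R * R)).

Definition zcoord (z : Z) (i : 'I_m) : R * R := (\val z : 'I_m -> R * R) i.

Lemma zcoord_continuous i : continuous (fun z => zcoord z i).
Proof.
move=> z; apply: (@continuous_comp _ _ _ set_val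
  (fun u : {ptws 'I_m -> (R * R)%type} => u i)); first exact: initial_continuous.
exact: (@proj_continuous _ (fun=> (R * R)%type : topologicalType)).
Qed.

Lemma zcoord_outside (z : Z) : exists2 s, s \in K & forall i, i \notin s ->
  1 <= nsq (zcoord z i).
Proof.
case: z => z zP; have [s sK H] := set_mem zP; exists s => // i /negPf is_.
by have := H i; rewrite is_ /circle /= => e; rewrite /nsq /zcoord /= e.
Qed.

Definition idx (i : 'I_m) : option 'I_6 := [pick b | vtx b == i].

Lemma idx_vtx b : idx (vtx b) = Some b.
Proof.
rewrite /idx; case: pickP => [c /eqP/vtx_inj-> //|/(_ b)].
by rewrite eqxx.
Qed.

(** The inclusion of the moment-angle complex of the full subcomplex on the image of [vtx], with the
    base point (1, 0) in the other coordinates. It is preceded by [retr], so that affine simplices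
    in the plane can be used. *)
Definition embed (u : 'I_6 -> R * R) : {ptws 'I_m -> (R * R)%type} :=
  fun i => if idx i is Some b then retr (u b) else (1, 0).

Lemma one_circle : circle ((1, 0) : R * R).
Proof. by rewrite /circle /= expr1n expr0n addr0. Qed.

Lemma embed_in (u : 'I_6 -> R * R) (s : {set 'I_6}) : s \in P26 ->
  (forall b, b \notin s -> 1 <= nsq (u b)) -> moment_angle_set K (embed u).
Proof.
rewrite -vtxK => sK Hu; exists (vtx @: s)%SET => // i; rewrite /embed.
case: ifP => [_|is_].
  case: (idx i) => [b|]; first exact: retr_disk.
  by have := one_circle; rewrite /circle /disk /= => ->.
rewrite /idx; case: pickP => [b /eqP bi|_]; last exact: one_circle.
apply: retr_circle; apply: Hu; apply: contraFN is_ => bs.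
by rewrite -bi; exact: imset_f.
Qed.

Definition good k (w : seq point) : Prop :=
  forall t : std_simplex R k, moment_angle_set K (embed (fun b => aff_point w t b)).

Definition base_val : {ptws 'I_m -> (R * R)%type} := fun=> (1, 0).

Lemma base_in : moment_angle_set K base_val.
Proof. by exists finset.set0 => // i; rewrite finset.in_set0; exact: one_circle. Qed.

(* Constant when the affine simplex spanned by w leaves the moment-angle complex. *)
Definition spx_val k w (t : std_simplex R k) : {ptws 'I_m -> (R * R)%type} :=
  if `[< good k w >] then embed (fun b => aff_point w t b) else base_val.

Lemma spx_in k w (t : std_simplex R k) : spx_val w t \in moment_angle_set K.
Proof.
apply/mem_set; rewrite /spx_val; case: asboolP => [|_]; first exact.
exact: base_in.
Qed.

Definition spx_fun k w (t : std_simplex R k) : Z :=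
  exist (fun u => u \in moment_angle_set K) _ (spx_in w t).

Lemma spx_continuous k w : continuous (@spx_fun k w).
Proof.
apply: continuous_comp_initial; change (continuous (@spx_val k w)).
apply: ptws_continuous => i; rewrite /spx_val /embed.
case: asboolP => _; last exact: cst_continuous.
case: (idx i) => [b|]; last exact: cst_continuous.
move=> t; apply: (@continuous_comp _ _ _ (fun t => aff_point w t b) retr).
  exact: aff_point_continuous.
exact: retr_continuous.
Qed.

HB.instance Definition _ k w := @isContinuous.Build _ _ (@spx_fun k w) (@spx_continuous
  k w).

Definition spx k w : singular_simplex R Z k := @spx_fun k w.

Lemma zcoord_spx k w (t : std_simplex R k) b : good k w ->
  zcoord (spx k w t) (vtx b) = retr (aff_point w t b).
Proof. by move=> gw; rewrite /zcoord /= /spx_val asboolT // /embed idx_vtx. Qed.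

Lemma spx_lift k w (i : 'I_k.+2) : size w = k.+2 -> good k.+1 w ->
  simplex_pull (lift i) (spx k.+1 w) = spx k (del i w).
Proof.
move=> sw gw.
have E t : embed (fun b => aff_point w (simplex_map R (lift i) t) b) =
    embed (fun b => aff_point (del i w) t b).
  by apply/funext => j; rewrite /embed; case: (idx j) => // b; rewrite aff_point_lift.
have gd : good k (del i w) by move=> t; rewrite -E; exact: gw.
apply/continuousEP => t; apply/val_inj => /=.
by rewrite /spx_val !asboolT // E.
Qed.

(* A local cochain of degree 2 in the coordinate b is nonzero on tuples of W only
   in the third case. *)
Definition small (W : set Z) : Prop := forall b,
  [\/ forall z z', W z -> W z' -> in_right (zcoord z (vtx b)) =
    in_right (zcoord z' (vtx b)),
      forall z z', W z -> W z' -> in_upper (zcoord z (vtx b)) =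
        in_upper (zcoord z' (vtx b)) |
      forall z, W z -> nsq (zcoord z (vtx b)) < 1].

Lemma small_sub U V : V `<=` U -> small U -> small V.
Proof.
move=> VU SU b; case: (SU b) => H; [constructor 1|constructor 2|constructor 3].
- by move=> z z' /VU ? /VU ?; exact: H.
- by move=> z z' /VU ? /VU ?; exact: H.
- by move=> z /VU ?; exact: H.
Qed.

(** In each of the six coordinates, the point is in the open disk, which is an open condition, or it
    is nonzero; then one of its two real coordinates is nonzero and keeps its sign nearby. *)
Lemma small_nbhs (z : Z) : exists2 U, nbhs z U & small U.
Proof.
have H b : exists2 U : set Z, nbhs z U &
  [\/ forall z z', U z -> U z' -> in_right (zcoord z (vtx b)) =
    in_right (zcoord z' (vtx b)),
      forall z z', U z -> U z' -> in_upper (zcoord z (vtx b)) =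
        in_upper (zcoord z' (vtx b)) |
      forall z, U z -> nsq (zcoord z (vtx b)) < 1].
  have nb (u : R * R -> R) (V : set R) : continuous u -> open V ->
      V (u (zcoord z (vtx b))) -> nbhs z [set z' | V (u (zcoord z' (vtx b)))].
    move=> uc oV Vz; apply: (@continuous_comp _ _ _ (fun z => zcoord z (vtx b)) u z).
    - exact: zcoord_continuous.
    - exact: uc.
    - exact: open_nbhs_nbhs.
  have [z1|z1] := ltP (nsq (zcoord z (vtx b))) 1.
    exists [set z' | nsq (zcoord z' (vtx b)) < 1]; last by constructor 3.
    exact: (nb _ _ nsq_continuous (@open_lt R 1) z1).
  have [xp|xn|x0] := ltrgt0P (zcoord z (vtx b)).1.
  - exists [set z' | 0 < (zcoord z' (vtx b)).1].
      exact: (nb _ _ fst_continuous (@open_gt R 0) xp).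
    by constructor 1 => y y' /= y0 y'0; rewrite /in_right y0 y'0.
  - exists [set z' | (zcoord z' (vtx b)).1 < 0].
      exact: (nb _ _ fst_continuous (@open_lt R 0) xn).
    by constructor 1 => y y' /= y0 y'0; rewrite /in_right !ltNge !ltW.
  have [yp|yn|y0] := ltrgt0P (zcoord z (vtx b)).2.
  - exists [set z' | 0 < (zcoord z' (vtx b)).2].
      exact: (nb _ _ snd_continuous (@open_gt R 0) yp).
    by constructor 2 => y y' /= y0 y'0; rewrite /in_upper y0 y'0.
  - exists [set z' | (zcoord z' (vtx b)).2 < 0].
      exact: (nb _ _ snd_continuous (@open_lt R 0) yn).
    by constructor 2 => y y' /= y0 y'0; rewrite /in_upper !ltNge !ltW.
  by move: z1; rewrite /nsq x0 y0 expr0n addr0 ler10.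
have [U HU] := choice (fun b => let: ex_intro2 U p q := H b in
   ex_intro (fun U => nbhs z U /\ _) U (conj p q)).
exists [set z' | forall b, U b z'].
  by apply: (@filter_forall _ _ _ _ (nbhs_filter z)) => b; have [] := HU b.
move=> b; have [_ [h|h|h]] := HU b; [constructor 1|constructor 2|constructor 3].
- by move=> y y' /(_ b) ? /(_ b) ?; exact: h.
- by move=> y y' /(_ b) ? /(_ b) ?; exact: h.
- by move=> y /(_ b) ?; exact: h.
Qed.

End MomentAngleSimplices.

Lemma supported_nth (X : eqType) (x0 : X) o i m w k : supported x0 o i m w ->
  (k < size m)%N ->
  exists2 e, e \in cell o i (nth false m k) & forall z, z \in w -> nth x0 z k \in e.2.
Proof.
elim: m w k => [//|b m IH] w [|k] /= [[e eb ew] sw] km.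
  by exists e => // z /ew; rewrite -nth0.
have [e' eb' ew'] := IH _ k sw km; exists e' => // z zw.
by rewrite -nth_behead; apply: ew'; exact: map_f.
Qed.

Lemma cup_word_map (X : eqType) (x0 : X) (g h : X -> 'F_2) (r : X -> X) m w :
  r x0 = x0 -> (forall x, g (r x) = g x) -> (forall x, h (r x) = h x) ->
  cup_word x0 g h m (map (map r) w) = cup_word x0 g h m w.
Proof.
move=> r0 gr hr; have local_r b v : local_cochain g h b (map r v) =
  local_cochain g h b v.
  by case: b; case: v => [|p [|q [|s [|]]]] //=; rewrite ?gr ?hr.
elim: m w => [|b m IH] w /=; first by rewrite size_map.
have -> : map (head x0) (take b.+2 (map (map r) w)) =
    map r (map (head x0) (take b.+2 w)).
  by rewrite -map_take -!map_comp; apply: eq_map => -[|x z].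
have -> : map behead (drop b.+1 (map (map r) w)) =
    map (map r) (map behead (drop b.+1 w)).
  by rewrite -map_drop -!map_comp; apply: eq_map => -[|x z].
by rewrite local_r IH.
Qed.

(** * The local cocycle and the simplices of the product chains *)

Section Representative.
Context {R : realType} {m : nat} (K : {set {set 'I_m}}) (vtx : 'I_6 -> 'I_m).
Hypothesis K0 : finset.set0 \in K.
Hypothesis KS : forall s t : {set 'I_m}, s \in K -> t \subset s -> t \in K.
Hypothesis vtx_inj : injective vtx.
Hypothesis vtxK : forall s : {set 'I_6}, ((vtx @: s)%SET \in K) = (s \in P26).
Local Notation Z := (moment_angle R K).
Local Notation point := (seq (R * R)).
Local Notation in_cellZ := (in_prod_cell (0 : R * R) corner icorner).
Local Notation spxZ := (spx vtx K0).
Local Notation goodZ := (good (R := R) K vtx).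

(** In a coordinate outside the face, the letters lie on one side of the square, hence so does their
    affine simplex, and [retr] maps it into the circle. *)
Lemma prod_cell_good k mask (w : seq point) : size mask = 6%N -> is_face mask ->
  in_cellZ mask w ->
  size w = k.+1 -> goodZ k w.
Proof.
move=> s6 + [_ sw _] szw t; rewrite is_faceE => fm.
apply: (embed_in vtxK fm) => b; rewrite inE => nb.
have [|e + ew] := supported_nth (k := b) sw; first by rewrite s6.
rewrite (negPf nb) => /circ_side[c c1 ec].
have E (u : 'I_k.+1 -> R) : (forall a, u a = c) -> \sum_a coord t a * u a = c.
  by move=> uc; under eq_bigr do rewrite uc; rewrite -mulr_suml coord_sum mul1r.
have inw (a : 'I_k.+1) : nth [::] w a \in w by rewrite mem_nth // szw.
rewrite /nsq; case: ec => ec.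
  have -> : (aff_point w t b).1 = c by apply: E => a; apply: ec; exact: ew.
  by rewrite c1 lerDl sqr_ge0.
have -> : (aff_point w t b).2 = c by apply: E => a; apply: ec; exact: ew.
by rewrite c1 lerDr sqr_ge0.
Qed.

Lemma prod_cell_small k mask (w : seq point) : size mask = 6%N -> is_face mask ->
  in_cellZ mask w ->
  size w = k.+1 -> small (K := K) vtx (range (spxZ k w)).
Proof.
move=> s6 fm sw szw b; have gw := prod_cell_good s6 fm sw szw.
have [_ sw' _] := sw.
have [|e eb ew] := supported_nth (k := b) sw'; first by rewrite s6.
have inw (a : 'I_k.+1) : nth 0 (nth [::] w a) b \in e.2.
  by apply: ew; rewrite mem_nth // szw.
have h2 : (0 : R) < 2^-1 by rewrite invr_gt0.
have [[H|H|H|H]|H] := cell_small eb.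
- constructor 1 => _ _ [t _ <-] [t' _ <-];
  rewrite !zcoord_spx // !in_right_retr /in_right.
  by rewrite !(lt_le_trans h2) //; apply: coord_sum_ge => a; exact: (H _ (inw a)).
- constructor 1 => _ _ [t _ <-] [t' _ <-];
  rewrite !zcoord_spx // !in_right_retr /in_right.
  have N (u : std_simplex R k) : (0 < (aff_point w u b).1) = false.
    apply/negbTE; rewrite -leNgt; apply: (@le_trans _ _ (- 2^-1)); last by lra.
    by apply: coord_sum_le => a; exact: (H _ (inw a)).
  by rewrite !N.
- constructor 2 => _ _ [t _ <-] [t' _ <-];
  rewrite !zcoord_spx // !in_upper_retr /in_upper.
  by rewrite !(lt_le_trans h2) //; apply: coord_sum_ge => a; exact: (H _ (inw a)).
- constructor 2 => _ _ [t _ <-] [t' _ <-];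
  rewrite !zcoord_spx // !in_upper_retr /in_upper.
  have N (u : std_simplex R k) : (0 < (aff_point w u b).2) = false.
    apply/negbTE; rewrite -leNgt; apply: (@le_trans _ _ (- 2^-1)); last by lra.
    by apply: coord_sum_le => a; exact: (H _ (inw a)).
  by rewrite !N.
constructor 3 => _ [t _ <-]; rewrite zcoord_spx //; apply: nsq_retr_lt1.
have L1 : - 2^-1 <= (aff_point w t b).1 by apply: coord_sum_ge => a;
  case/and4P: (H _ (inw a)).
have L2 : (aff_point w t b).1 <= 2^-1 by apply: coord_sum_le => a;
  case/and4P: (H _ (inw a)).
have L3 : - 2^-1 <= (aff_point w t b).2 by apply: coord_sum_ge => a;
  case/and4P: (H _ (inw a)).
have L4 : (aff_point w t b).2 <= 2^-1 by apply: coord_sum_le => a;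
  case/and4P: (H _ (inw a)).
by rewrite /nsq; nra.
Qed.

Definition coords (z : Z) : point := [seq zcoord z (vtx b) | b <- enum 'I_6].

Lemma size_coords z : size (coords z) = 6%N.
Proof. by rewrite size_map size_enum_ord. Qed.

Lemma nth_coords z (b : 'I_6) : nth 0 (coords z) b = zcoord z (vtx b).
Proof. by rewrite (nth_map ord0) ?size_enum_ord // nth_ord_enum. Qed.

Definition vword k (s : singular_simplex R Z k) : seq point :=
  [seq coords (s v) | v <- verts k].

Definition class_word (w : seq point) : 'F_2 :=
  \sum_(e <- cocycle_edges) cup_word 0 in_right in_upper e w.

Definition class_cochain : cochain R 'F_2 Z 8 := fun s => class_word (vword s).

Lemma vword_lift k (s : singular_simplex R Z k.+1) (i : 'I_k.+2) :
  vword (simplex_pull (lift i) s) = del i (vword s).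
Proof.
rewrite /vword -map_del -(map_aff_verts (w := del i (verts k.+1)) (k := k)).
  rewrite -[RHS]map_comp; apply: eq_map => v /=; congr (coords (s _)).
  by rewrite -aff_lift ?size_verts // aff_verts.
by rewrite size_del size_verts.
Qed.

(** By [raise_cocycle_sum] it suffices that a nonzero term [t] is a face. By [cup_word_const], the
    coordinates in [t] must satisfy the third alternative of [small], so at any point of [s] they
    lie inside the disk and belong to a simplex of [K]. *)
Lemma coboundary_class_small (s : singular_simplex R Z 9) :
  small (K := K) vtx (range s) -> coboundary class_cochain s = 0.
Proof.
move=> Ss; have szs : size (vword s) = 10%N by rewrite size_map size_verts.
transitivity (wdiff class_word (vword s)).
  by rewrite wdiffE szs; apply: eq_bigr => i _; rewrite /class_cochain vword_lift.
rewrite wdiff_sum; transitivity (\sum_(e <- cocycle_edges) \sum_(t <- raise_mask e)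
    cup_word 0 in_right in_upper t (vword s)).
  apply: eq_big_seq => e /size_cocycle_edges [_ e8].
  by rewrite wdiff_cup_word // e8.
apply: raise_cocycle_sum => t t6; apply: contraNeq => Ct.
rewrite is_faceE -vtxK.
(* Any point of the simplex would do; the first vertex is taken. *)
have [S SK HS] := zcoord_outside (s (vert ord0)).
apply: (KS SK); apply/fintype.subsetP => _ /imsetP[b + ->]; rewrite inE => tb.
have inr y : y \in vword s -> exists2 z, range s z & y = coords z.
  by move=> /mapP[v _ ->]; exists (s v) => //; exists v.
apply: contraNT Ct => nS; apply/eqP; apply: (cup_word_const (k := b)) => //.
case: (Ss b) => H; [left|right|exfalso].
- by move=> _ _ /inr[z rz ->] /inr[z' rz' ->]; rewrite !nth_coords; exact: H.
- by move=> _ _ /inr[z rz ->] /inr[z' rz' ->]; rewrite !nth_coords; exact: H.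
have := H (s (vert ord0)); rewrite ltNge HS // => /(_ _)/negP; apply => //.
Qed.

(** The vertices of the singular simplex are the retracted letters, and [retr] changes neither
    [in_right] nor [in_upper]. *)
Lemma class_cochain_spx (w : seq point) : goodZ 8 w -> size w = 9%N ->
  (forall z, z \in w -> size z = 6%N) -> class_cochain (spxZ 8 w) = class_word w.
Proof.
move=> gw sw zw.
have -> : class_cochain (spxZ 8 w) = class_word (map (map retr) w).
  congr class_word; apply: (@eq_from_nth _ [::]) => [|a];
    rewrite /vword size_map size_verts.
    by rewrite size_map sw.
  move=> a9.
  rewrite (nth_map (vert ord0)) ?size_verts // (nth_verts _ (Ordinal a9)).
  rewrite (nth_map [::]) ?sw //; apply: (@eq_from_nth _ 0) => [|b].
    by rewrite size_coords size_map zw ?mem_nth ?sw.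
  rewrite size_coords => b6; rewrite (nth_coords _ (Ordinal b6)) zcoord_spx //.
  by rewrite aff_point_vert (nth_map 0) ?zw ?mem_nth ?sw.
apply: eq_bigr => e _; apply: cup_word_map;
  [exact: retr0|exact: in_right_retr|exact: in_upper_retr].
Qed.

End Representative.

(** * Product chains under ring morphisms and along filters *)

Section Naturality.
Context {X : eqType} (o i : 'I_4 -> X).

Lemma shuffle_rmorph (A B : comNzRingType) (r : {rmorphism A -> B}) (Y V W : eqType)
  (c : Y -> V -> W) s (f : seq W -> A) t :
  r (shuffle c s f t) = shuffle c s (fun w => r (f w)) t.
Proof.
elim: s t f => [|x s IHs]; first by move=> *; rewrite !shuffle_nill rmorph0.
elim=> [|y t IHt] f; first by rewrite !shuffle_nilr rmorph0.
rewrite !shuffle_cons !rmorphD rmorphM rmorph_sign IHs IHt; congr (_ + _ + _).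
by case: ifP; rewrite ?rmorph0.
Qed.

Lemma prod_cell_rmorph (A B : comNzRingType) (r : {rmorphism A -> B}) m
  (f : seq (seq X) -> A) : r (prod_cell o i m f) = prod_cell o i m (fun w => r (f w)).
Proof.
elim: m f => [//|b m IH] f /=; rewrite /ev_chain rmorph_sum; apply: eq_bigr => p _.
rewrite rmorphM rmorph_sign IH; congr (_ * prod_cell _ _ _ _).
by apply/funext => t; rewrite shuffle_rmorph.
Qed.

Context {A : comNzRingType} {T : Type} (F : set_system T).
Hypothesis FF : Filter F.

Lemma sum_near (I : Type) (l : seq I) (a : T -> I -> A) (a' : I -> A) :
  (forall p, \forall N \near F, a N p = a' p) ->
  \forall N \near F, \sum_(p <- l) a N p = \sum_(p <- l) a' p.
Proof.
move=> H; elim: l => [|p l IH]; first by apply: filterE => N; rewrite !big_nil.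
by apply: filterS2 (H p) IH => N e1 e2; rewrite !big_cons e1 e2.
Qed.

Lemma shuffle_near (Y V W : eqType) (c : Y -> V -> W) s t (f : T -> seq W -> A) g :
  (forall w, \forall N \near F, f N w = g w) ->
  \forall N \near F, shuffle c s (f N) t = shuffle c s g t.
Proof.
elim: s t f g => [|x s IHs]; first by move=> *; exact: filterE.
elim=> [|y t IHt] f g H; first by apply: filterE => N; rewrite !shuffle_nilr.
have := IHs (y :: t) (fun N u => f N (c x y :: u)) (fun u => g (c x y :: u))
  (fun w => H _).
have := IHt (fun N u => f N (c x y :: u)) (fun u => g (c x y :: u)) (fun w => H _).
by apply: filterS3 (H [:: c x y]) => N e1 e2 e3; rewrite !shuffle_cons e1 e2 e3.
Qed.

(** A product chain involves finitely many words, so eventual equality on each word is enough. *)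
Lemma prod_cell_near m (f : T -> seq (seq X) -> A) g :
  (forall w, \forall N \near F, f N w = g w) ->
  \forall N \near F, prod_cell o i m (f N) = prod_cell o i m g.
Proof.
elim: m f g => [|b m IH] f g H /=; first exact: H.
apply: sum_near => p; have := IH (fun N => shuffle cons p.2 (f N)) (shuffle cons p.2 g)
  (fun t => shuffle_near _ _ _ H).
by apply: filterS => N ->.
Qed.

End Naturality.

(** * The Bockstein of the limit cocycle *)

Section NonzeroSquare.
Context {R : realType} {m : nat} (K : {set {set 'I_m}}) (vtx : 'I_6 -> 'I_m).
Hypothesis K0 : finset.set0 \in K.
Hypothesis KS : forall s t : {set 'I_m}, s \in K -> t \subset s -> t \in K.
Hypothesis vtx_inj : injective vtx.
Hypothesis vtxK : forall s : {set 'I_6}, ((vtx @: s)%SET \in K) = (s \in P26).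
Local Notation Z := (moment_angle R K).
Local Notation point := (seq (R * R)).
Local Notation in_cellZ := (in_prod_cell (0 : R * R) corner icorner).
Local Notation spxZ := (spx vtx K0).
Local Notation cellZ := (prod_cell (corner (R := R)) icorner).
Local Notation smallZ := (small (R := R) (K := K) vtx).

(** The value 0 at other lengths includes the empty word, as [prod_cell_wdiff] requires. *)
Definition on_words (A : comNzRingType) k (z : cochain R A Z k) (w : seq point) : A :=
  if size w == k.+1 then z (spxZ k w) else 0.

Lemma prod_cell_coboundary (A : comNzRingType) k (z : cochain R A Z k) mask :
  size mask = 6%N -> is_face mask -> deg mask = k.+1 ->
  cellZ mask (on_words (coboundary z)) = cellZ mask (wdiff (on_words z)).
Proof.
move=> s6 fm dk; apply: (eq_prod_cell (x0 := 0)) => w sw.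
have szw : size w = k.+2 by have [-> _ _] := sw; rewrite dk.
have gw := prod_cell_good vtxK s6 fm sw szw.
rewrite /on_words szw eqxx wdiffE szw; apply: eq_bigr => a _.
by rewrite size_del szw //= eqxx spx_lift.
Qed.

(** Evaluation on the chain D; [pair_chain] is evaluation on C. *)
Definition pair_cycle (A : comNzRingType) (z : cochain R A Z 8) : A :=
  \sum_(p <- cycle_edges) (-1) ^+ p.1 * cellZ p.2 (on_words z).
Definition pair_chain (A : comNzRingType) (z : cochain R A Z 9) : A :=
  \sum_(mask <- facet_masks) cellZ mask (on_words z).

Lemma pair_chain_coboundary (A : comNzRingType) (z : cochain R A Z 8) :
  pair_chain (coboundary z) = 2 * pair_cycle z.
Proof.
rewrite /pair_cycle -(sum_bd_facets (fun mask => cellZ mask (on_words z))).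
apply: eq_big_seq => mask /size_facet_masks [s6 d9 fm].
by rewrite prod_cell_coboundary // prod_cell_wdiff.
Qed.

Lemma pair_cycle_coboundary (A : comNzRingType) (y : cochain R A Z 7) :
  pair_cycle (coboundary y) = 0.
Proof.
rewrite -[RHS](sum_bd_cycle (fun mask => cellZ mask (on_words y))).
apply: eq_big_seq => p /size_cycle_edges [s6 d8 fm].
by rewrite prod_cell_coboundary // prod_cell_wdiff.
Qed.

Lemma on_words_red2 k (w : cochain R int Z k) :
  on_words (red2 w) = (fun u => (on_words w u)%:~R : 'F_2).
Proof. by apply/funext => u; rewrite /on_words; case: ifP. Qed.

Lemma pair_chain_red2 w : pair_chain (red2 w) = (pair_chain w)%:~R.
Proof.
rewrite /pair_chain rmorph_sum; apply: eq_bigr => mask _.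
by rewrite (prod_cell_rmorph _ _ (intr : {rmorphism int -> 'F_2})) on_words_red2.
Qed.

Lemma pair_cycle_red2 w : pair_cycle (red2 w) = (pair_cycle w)%:~R.
Proof.
rewrite /pair_cycle rmorph_sum; apply: eq_bigr => p _.
by rewrite rmorphM rmorph_sign (prod_cell_rmorph _ _ (intr : {rmorphism int ->
  'F_2})) on_words_red2.
Qed.

(** By the duality [prod_cell_cup], this counts mod 2 the edges common to the cycle and the
    cocycle. *)
Lemma pair_cycle_class : pair_cycle (class_cochain vtx (K := K)) = 1.
Proof.
rewrite -cocycle_cycle; apply: eq_big_seq => p /size_cycle_edges [s6 d8 fm].
congr (_ * _); transitivity (cellZ p.2 (class_word (R := R))).
  apply: (eq_prod_cell (x0 := 0)) => w sw; have [szw _ zw] := sw.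
  rewrite d8 in szw; rewrite /on_words szw eqxx class_cochain_spx //.
    exact: (prod_cell_good vtxK s6 fm sw szw).
  by move=> z /zw ->.
rewrite /class_word; transitivity (\sum_(e <- cocycle_edges) cellZ p.2 (cup_word 0
  in_right in_upper e)).
  elim: cocycle_edges => [|e l IH].
    under [X in prod_cell _ _ _ X]funext do rewrite big_nil.
    by rewrite prod_cell0 big_nil.
  under [X in prod_cell _ _ _ X]funext do rewrite big_cons.
  by rewrite prod_cellD IH big_cons.
apply: eq_big_seq => e /size_cocycle_edges [e6 _].
by rewrite (prod_cell_cup _ _ ev_circ_corner) // s6.
Qed.

Lemma pair_cycleD (A : comNzRingType) (y z : cochain R A Z 8) :
  pair_cycle (y + z) = pair_cycle y + pair_cycle z.
Proof.
rewrite /pair_cycle -big_split; apply: eq_bigr => p _; rewrite /= -mulrDr -prod_cellD.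
congr (_ * prod_cell _ _ _ _); apply/funext => w; rewrite /on_words.
by case: ifP; rewrite ?addr0.
Qed.

Lemma pair_chainD (A : comNzRingType) (y z : cochain R A Z 9) :
  pair_chain (y + z) = pair_chain y + pair_chain z.
Proof.
rewrite /pair_chain -big_split; apply: eq_bigr => p _; rewrite /= -prod_cellD.
congr (prod_cell _ _ _ _); apply/funext => w; rewrite /on_words.
by case: ifP; rewrite ?addr0.
Qed.

Definition small_zero k (y : cochain R 'F_2 Z k) :=
  forall s : singular_simplex R Z k, smallZ (range s) -> y s = 0.

Lemma pull_aff_range k l (s : singular_simplex R Z k) v :
  range (pull_aff l s v) `<=` range s.
Proof. by move=> _ [t _ <-]; exists (aff v t). Qed.

(** In the homotopy formula [sing_htpyP], the coboundary term vanishes because D is a cycle, and the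
    other one because the simplices of D are small. *)
Lemma pair_cycle_subdiv (z : cochain R 'F_2 Z 8) : small_zero (coboundary z) ->
  pair_cycle (sing_subdiv z) = pair_cycle z.
Proof.
move=> z0.
have h0 : pair_cycle (sing_htpy (coboundary z)) = 0.
  rewrite /pair_cycle big1_seq // => p /andP[_ /size_cycle_edges [s6 d8 fm]].
  rewrite (eq_prod_cell (x0 := 0) (f' := fun=> 0)) ?prod_cell0 ?mulr0 // => w sw.
  have szw : size w = 9%N by have [-> _ _] := sw; rewrite d8.
  rewrite /on_words szw eqxx; apply: subdiv_htpy_eq0; first exact: size_verts.
  move=> v _; apply: z0; apply: small_sub (@pull_aff_range _ _ _ _) _.
  exact: (prod_cell_small K0 vtx_inj vtxK s6 fm sw szw).
have /(congr1 (@pair_cycle _)) := sing_htpyP z.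
rewrite (pair_cycleD z) (pair_cycleD (sing_htpy (coboundary z))) pair_cycle_coboundary
  h0 addr0 => /eqP.
by rewrite addrC addr_eq0 oppF2 => /eqP.
Qed.

Lemma small_zero_subdiv k (y : cochain R 'F_2 Z k) : small_zero y ->
  small_zero (sing_subdiv y).
Proof.
move=> y0 s Ss; rewrite /sing_subdiv; apply: subdiv_eq0; rewrite ?size_verts // => v _.
by apply: y0; apply: small_sub (@pull_aff_range _ _ _ _) Ss.
Qed.

Lemma coboundary_iter_subdiv N (z : cochain R 'F_2 Z 8) :
  coboundary (iter N (@sing_subdiv R Z 8) z) =
    iter N (@sing_subdiv R Z 9) (coboundary z).
Proof. by elim: N => //= N <-; rewrite coboundary_subdiv. Qed.

Lemma iter_small_zero N k (y : cochain R 'F_2 Z k) :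
  small_zero y -> small_zero (iter N (@sing_subdiv R Z k) y).
Proof. by move=> y0; elim: N => //= N; exact: small_zero_subdiv. Qed.

Lemma class_small_zero : small_zero (coboundary (class_cochain vtx (K := K))).
Proof. by move=> s; exact: coboundary_class_small. Qed.

Lemma pair_cycle_iter N : pair_cycle (iter N (@sing_subdiv R Z 8) (class_cochain vtx (K
  := K))) = 1.
Proof.
elim: N => [|N IH] /=; first exact: pair_cycle_class.
rewrite pair_cycle_subdiv ?IH // coboundary_iter_subdiv.
exact: iter_small_zero class_small_zero.
Qed.

(** Lebesgue's lemma for the sets whose image under [s] is small; the bound on [N] depends on
    [s]. *)
Lemma iter_subdiv_near0 k (y : cochain R 'F_2 Z k) (s : singular_simplex R Z k) :
  small_zero y -> \forall N \near \oo, iter N (@sing_subdiv R Z k) y s = 0.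
Proof.
move=> y0; pose r : R := k%:R / k.+1%:R.
have r0 : 0 <= r by rewrite divr_ge0.
have r1 : r < 1 by rewrite ltr_pdivrMr ?ltr0n // mul1r ltr_nat.
have W (x : std_simplex R k) : exists2 U : set (std_simplex R k),
  nbhs x U & smallZ (s @` U).
  have [V nV SV] := small_nbhs vtx (s x).
  exists (s @^-1` V); first exact: cts_fun nV.
  by apply: small_sub SV => _ [t Vt <-].
have WS (U V : set (std_simplex R k)) : V `<=` U -> smallZ (s @` U) -> smallZ (s @` V).
  by move=> VU; apply: small_sub; exact: image_subset.
have := simplex_lebesgue k r0 r1 W WS; apply: filterS => N H.
rewrite -(pull_aff_verts s); apply: (iter_subdiv_eq0 (d := 1)) => //.
- exact: size_verts.
- move=> i p q _ _; have coord_le1 (t : std_simplex R k) : coord t i <= 1.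
    by rewrite -(coord_sum t) (bigD1 i) //= lerDl; apply: sumr_ge0 => a _;
      exact: coord_ge0.
  by rewrite ler_norml; have := coord_ge0 p i; have := coord_ge0 q i;
    have := coord_le1 p;
    have := coord_le1 q; lra.
move=> v sv; rewrite mulr1 => dv; apply: y0.
by apply: small_sub (H v sv dv) => _ [t _ <-]; exists (aff v t) => //; exists t.
Qed.

Lemma exists_cocycle : exists2 x : cochain R 'F_2 Z 8, coboundary x =
  0 & pair_cycle x = 1.
Proof.
have [U [UU oU]] := ultraFilterLemma (_ : ProperFilter \oo).
pose a N := iter N (@sing_subdiv R Z 8) (class_cochain vtx (K := K)).
(* A sequence with values in a set of two elements is constant on a member of the ultrafilter. *)
have H s : exists b : 'F_2, \forall N \near U, a N s = b.
  have [H|H] := in_ultra_setVsetC [set N | a N s = 1] UU; first by exists 1.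
  exists 0; apply: filterS H => N /= a1.
  by case: (a N s) a1 => [[|[|c]] i] // H; [exact/val_inj|case: H; exact/val_inj].
have [x Hx] := choice H; exists x.
  apply/funext => s.
  (* The coboundary at [s] involves ten faces only, so one [N] gives the limit on all of them. *)
  have near_faces : \forall N \near U, forall i : 'I_10,
      a N (simplex_pull (lift i) s) = x (simplex_pull (lift i) s).
    by apply: filter_forall => i; exact: Hx.
  have near0 : \forall N \near U, coboundary (a N) s = 0.
    apply: oU; have := iter_subdiv_near0 s class_small_zero.
    by apply: filterS => N; rewrite /a coboundary_iter_subdiv.
  have [N [e1 e2]] := filter_ex (filterI near_faces near0).
  by rewrite -[RHS]e2; apply: eq_bigr => i _; rewrite e1.
have near_x : \forall N \near U, pair_cycle (a N) = pair_cycle x.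
  apply: sum_near => p.
  have : \forall N \near U, cellZ p.2 (on_words (a N)) = cellZ p.2 (on_words x).
    by apply: prod_cell_near => w; apply: filterS (Hx (spxZ 8 w)) => N e;
      rewrite /on_words e.
  by apply: filterS => N ->.
have [N <-] := filter_ex near_x; exact: pair_cycle_iter.
Qed.

Lemma Sq1_nonzero : exists x : cohomology R 'F_2 Z 8, Sq1 x != 0.
Proof.
have [x x0 x1] := exists_cocycle.
have xP : x \in @cocycle_pred R 'F_2 Z 8 by apply/eqP.
exists (\pi_(cohomology R 'F_2 Z 8) (Cocycle xP))%qT.
apply/negP => /eqP; rewrite Sq1_pi => /cohomology_eq0 [y] /= xy.
have [|w xw] := @red2_eq0 _ _ _ (coboundary (lift2 x)).
  by rewrite -coboundary_red2 lift2K.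
rewrite (Sq1_bockstein xw) in xy.
(* Over the integers, 2 w(C) is the coboundary of the lift evaluated on C, which is twice the value
   of the lift on D; the factor 2 cancels. *)
have Cw : pair_chain w = pair_cycle (lift2 x).
  apply: (@mulfI _ 2) => //; rewrite -pair_chain_coboundary xw pair_chainD.
  by rewrite mulr_natl mulr2n.
(* The left side reduces to x(D) = 1 mod 2, the right side is 2 y(D) = 0. *)
have := congr1 (@pair_chain _) xy.
rewrite pair_chain_red2 Cw -pair_cycle_red2 lift2K x1 pair_chain_coboundary.
by rewrite mulr_natl mulr2n addF2.
Qed.

End NonzeroSquare.

Theorem corollary4p3p3 (R : realType) (m : nat) (K : {set {set 'I_m}}) :
  simplicial_complex K -> contains_full K P26 ->
  exists (n : nat) (x : cohomology R 'F_2 (moment_angle R K) n), Sq1 x != 0.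
Proof.
move=> [K0 KS] [J [f [finj fJ fK]]]; exists 8.
have H b : exists i, i \in J /\ f i = b.
  have : b \in (f @: J)%SET by rewrite fJ inE.
  by move=> /imsetP[i iJ ->]; exists i.
(* The inverse of the isomorphism [f], with values in [J]; as the subcomplex on [J] is full,
   [vtx @: s] is in [K] exactly when [s] is in [P26]. *)
have [vtx Hvtx] := choice H.
have vtx_inj : injective vtx by move=> b c e; have [_ <-] := Hvtx b; rewrite e;
  case: (Hvtx c).
apply: (Sq1_nonzero (vtx := vtx) K0 KS vtx_inj) => s.
have sJ : (vtx @: s \subset J)%SET.
  by apply/fintype.subsetP => _ /imsetP[b _ ->]; case: (Hvtx b).
have := fK _ sJ; rewrite inE sJ andbT => ->.
rewrite -imset_comp (eq_imset (g := id)) ?imset_id // => b.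
by case: (Hvtx b).
Qed.
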